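(* Let $\delta\in(0,1/3)$, $n\ge1$, $d\ge1$, $\beta\ge2$ and $m\in\{1,\dots,n\}$ with $m\ge4\log(4(2n+1)^{2d}/\delta)$. Suppose that: (a) $(X,Y),(X_1,Y_1),\dots,(X_n,Y_n)$ are independent and identically distributed; (b) $X$ has a density $f_X$ on $[0,1]^d$ and there are constants $M,b>0$ with $b\le f_X(x)\le M$ for all $x\in[0,1]^d$; (c) conditionally on $X$, the noise $\varepsilon=Y-g(X)$ is sub-Gaussian with parameter $\sigma^2$: $\mathbb E[\varepsilon\mid X]=0$ and $\mathbb E[\exp(s\varepsilon)\mid X]\le\exp(s^2\sigma^2/2)$ for all $s\in\mathbb R$; (d) $g$ is $L$-Lipschitz on $[0,1]^d$ with respect to $\|\cdot\|_2$. Let $\mathcal V$ be the local map given by the final partition of the shape regular (SR) tree with input parameters $\beta$, $m$ and cost function $M_n$ (see context). Then, with probability at least $1-3\delta$, for all $x\in[0,1]^d$, $$|\hat g_{\mathcal V}(x)-g(x)|\le\sqrt{\frac{2\sigma^2}{m}\log\left(\frac{(n+1)^{2d}}{\delta}\right)}+L(\mathcal V(x))\,\beta\sqrt d\left(\frac{5m}{nb}\right)^{1/d}.$$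
   Context: $S_X=[0,1]^d$, $g(x)=\mathbb E[Y\mid X=x]$, $nP_n^X(V)=\sum_{i=1}^n\mathbf 1_V(X_i)$. For a hyper-rectangle $V$ with side lengths $h_k(V)$, $h_-(V)=\min_kh_k(V)$ and $h_+(V)=\max_kh_k(V)$. Splits: $S=\{1,\dots,d\}\times(0,1)$. A split $(p,u)\in S$ of a cell (hyper-rectangle) $V$ partitions $V$ by a cut orthogonal to coordinate $p$ into a left child $V(l)$ with $h_p(V(l))=u\,h_p(V)$ and a right child $V(r)$ with $h_p(V(r))=(1-u)h_p(V)$, other side lengths unchanged. Define $$S_\beta(V)=\{(p,u)\in S:h_+(V(s))\le\beta h_-(V(s))\ \forall s\in\{l,r\}\},$$ $$S_m(V)=\{(p,u)\in S:nP_n^X(V(s))\ge m\ \forall s\in\{l,r\}\}.$$ Cost function: $M_n:S\times\mathcal R([0,1]^d)\to\mathbb R$, where $\mathcal R([0,1]^d)$ is the set of hyper-rectangles in $[0,1]^d$; $M_n$ is arbitrary, may depend on the whole sample $(X_i,Y_i)_{i\le n}$, and is assumed to be such that for every cell $V$ with $S_m(V)\ne\emptyset$ considered by the construction, $(p,u)\mapsto M_n((p,u),V)$ has a minimizer on $S_\beta(V)\cap S_m(V)$. SR tree: start from the partition $\{[0,1]^d\}$. At each step, every cell $V$ of the current partition with $S_m(V)\ne\emptyset$ is replaced by its two children for a split minimizing $M_n(\cdot,V)$ over $S_\beta(V)\cap S_m(V)$; a cell with $S_m(V)=\emptyset$ is left unchanged. Stop when the partition no longer changes. $\mathcal V(x)$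 is the cell of the final partition containing $x$. The estimator is $\hat g_{\mathcal V}(x)=\sum_{i=1}^nY_i\mathbf 1_{\mathcal V(x)}(X_i)/\sum_{i=1}^n\mathbf 1_{\mathcal V(x)}(X_i)$, and $L(V)$ is the smallest constant $c$ with $|g(x)-g(y)|\le c\|x-y\|_2$ for all $x,y\in V$. *)

(* Defs.v *)
From HB Require Import structures.
From mathcomp Require Import all_boot all_order all_algebra.
From mathcomp Require Import all_classical all_reals all_analysis.

Set Implicit Arguments.
Unset Strict Implicit.
Unset Printing Implicit Defensive.

Import Order.TTheory GRing.Theory Num.Theory.
Import numFieldNormedType.Exports.

Local Open Scope classical_set_scope.
Local Open Scope ring_scope.

(* Points of R^d are tuples: the library equips [d.-tuple R] with the product
   sigma-algebra. *)

Definition dist2 (R : realType) (d : nat) (x y : d.-tuple R) : R :=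
  Num.sqrt (\sum_(k < d) (tnth x k - tnth y k) ^+ 2).

Definition unit_cube (R : realType) (d : nat) : set (d.-tuple R) :=
  [set x | forall k : 'I_d, 0 <= tnth x k <= 1].

Definition push_cons (R : realType) (d : nat)
    (mu : {measure set (d.-tuple R) -> \bar R}) :
    set (d.+1.-tuple R) -> \bar R :=
  pushforward (mu \x @lebesgue_measure R)%E
    (fun xt : d.-tuple R * R => [tuple of xt.2 :: xt.1]).

Section push_cons_measure.
Context (R : realType) (d : nat) (mu : {measure set (d.-tuple R) -> \bar R}).

Let measurable_pair_cons :
  measurable_fun setT
    (fun xt : d.-tuple R * R => [tuple of xt.2 :: xt.1] : d.+1.-tuple R).
Proof. exact: measurable_cons. Qed.

Let push_cons0 : push_cons mu set0 = 0%E.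
Proof. by rewrite /push_cons /pushforward preimage_set0 measure0. Qed.

Let push_cons_ge0 A : (0 <= push_cons mu A)%E.
Proof. exact: measure_ge0. Qed.

Let push_cons_sigma_additive : semi_sigma_additive (push_cons mu).
Proof.
move=> F mF tF mUF; rewrite /push_cons /pushforward preimage_bigcup.
apply: measure_semi_sigma_additive.
- by move=> n; rewrite -[X in measurable X]setTI; exact: measurable_pair_cons.
- apply/trivIsetP => /= i j _ _ ij; rewrite -preimage_setI.
  by move/trivIsetP : tF => /(_ _ _ _ _ ij) ->//; rewrite preimage_set0.
- by rewrite -preimage_bigcup -[X in measurable X]setTI; exact: measurable_pair_cons.
Qed.

HB.instance Definition _ := isMeasure.Build _ _ _ (push_cons mu)
  push_cons0 push_cons_ge0 push_cons_sigma_additive.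

End push_cons_measure.

(* Lebesgue measure on R^d, as the d-fold product of [lebesgue_measure]; on R^0
   it is the unit mass at the only point. *)
Fixpoint lebesgue_vec (R : realType) (d : nat) :
    {measure set (d.-tuple R) -> \bar R} :=
  match d with
  | 0%N => \d_ ([tuple] : 0.-tuple R)
  | d'.+1 => push_cons (lebesgue_vec R d')
  end.

Definition mutually_independent (R : realType) (dT : measure_display)
    (T : measurableType dT) (P : probability T R) (dS : measure_display)
    (S : measurableType dS) (I : finType) (Z : I -> {RV P >-> S}) : Prop :=
  forall (J : {set I}) (A : I -> set S), (forall i, measurable (A i)) ->
    P (\bigcap_(i in [set` J]) (Z i @^-1` A i)) =
    (\prod_(i in J) fine (P (Z i @^-1` A i)))%:E.

Definition identically_distributed (R : realType) (dT : measure_display)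
    (T : measurableType dT) (P : probability T R) (dS : measure_display)
    (S : measurableType dS) (I : finType) (Z : I -> {RV P >-> S}) : Prop :=
  forall (i j : I) (A : set S), measurable A ->
    distribution P (Z i) A = distribution P (Z j) A.

(* [h] is a version of the function s |-> E[Z | X = s]. *)
Definition is_cond_exp (R : realType) (dT : measure_display)
    (T : measurableType dT) (P : probability T R) (dS : measure_display)
    (S : measurableType dS) (X : T -> S) (Z : T -> R) (h : S -> R) : Prop :=
  [/\ P.-integrable setT (fun w => (Z w)%:E),
      measurable_fun setT h,
      P.-integrable setT (fun w => (h (X w))%:E) &
      forall A : set S, measurable A ->
        (\int[P]_(w in X @^-1` A) (Z w)%:E =
         \int[P]_(w in X @^-1` A) (h (X w))%:E)%E].

(* The bound on the conditional moment generating function is an almost sure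
   inequality, stated on a version of the conditional expectation. *)
Definition cond_subgaussian (R : realType) (dT : measure_display)
    (T : measurableType dT) (P : probability T R) (dS : measure_display)
    (S : measurableType dS) (X : T -> S) (eps : T -> R) (sigma2 : R) : Prop :=
  is_cond_exp P X eps (fun=> 0) /\
  forall s : R, exists h : S -> R,
    is_cond_exp P X (fun w => expR (s * eps w)) h /\
    {ae P, forall w, h (X w) <= expR (s ^+ 2 * sigma2 / 2)}.

Definition has_density_on_cube (R : realType) (dT : measure_display)
    (T : measurableType dT) (P : probability T R) (d : nat)
    (X : T -> d.-tuple R) (f : d.-tuple R -> R) : Prop :=
  measurable_fun (@unit_cube R d) f /\
  forall A : set (d.-tuple R), measurable A ->
    (P (X @^-1` A) =
     \int[lebesgue_vec R d]_(x in A `&` @unit_cube R d) (f x)%:E)%E.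

(* A hyper-rectangle is a product of intervals that may be open or closed at
   either end, so that a cut produces a genuine partition. *)
Definition cell (R : realType) (d : nat) := {ffun 'I_d -> interval R}.

Definition in_cell (R : realType) (d : nat) (V : cell R d) (x : d.-tuple R) :
    bool :=
  [forall k, tnth x k \in V k].

Definition root_cell (R : realType) (d : nat) : cell R d :=
  [ffun=> `[0, 1]].

(* All intervals in play are bounded; the value 0 for an infinite end is a
   dummy. *)
Definition itv_lo (R : realType) (i : interval R) : R :=
  if i is Interval (BSide _ a) _ then a else 0.
Definition itv_hi (R : realType) (i : interval R) : R :=
  if i is Interval _ (BSide _ b) then b else 0.

Definition side_length (R : realType) (d : nat) (V : cell R d) (k : 'I_d) : R :=
  itv_hi (V k) - itv_lo (V k).

(* The neutral elements 0 and 1 are harmless for d >= 1, because the side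
   lengths of a rectangle in [0,1]^d lie in [0,1]. *)
Definition h_plus (R : realType) (d : nat) (V : cell R d) : R :=
  \big[Num.max/0]_(k < d) side_length V k.
Definition h_minus (R : realType) (d : nat) (V : cell R d) : R :=
  \big[Num.min/1]_(k < d) side_length V k.

Definition sr_split (R : realType) (d : nat) := ('I_d * R)%type.

Definition all_splits (R : realType) (d : nat) : set (sr_split R d) :=
  [set s | 0 < s.2 < 1].

Definition cut_point (R : realType) (d : nat) (V : cell R d) (s : sr_split R d) :
    R :=
  itv_lo (V s.1) + s.2 * side_length V s.1.

(* The points on the cutting hyperplane go to the right child. *)
Definition left_child (R : realType) (d : nat) (V : cell R d) (s : sr_split R d) :
    cell R d :=
  [ffun k => if k == s.1
             then let: Interval a _ := V k in Interval a (BLeft (cut_point V s))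
             else V k].
Definition right_child (R : realType) (d : nat) (V : cell R d) (s : sr_split R d) :
    cell R d :=
  [ffun k => if k == s.1
             then let: Interval _ b := V k in Interval (BLeft (cut_point V s)) b
             else V k].

Definition shape_regular_splits (R : realType) (d : nat) (beta : R)
    (V : cell R d) : set (sr_split R d) :=
  [set s | [/\ @all_splits R d s,
               h_plus (left_child V s) <= beta * h_minus (left_child V s) &
               h_plus (right_child V s) <= beta * h_minus (right_child V s)]].

Definition sample (R : realType) (d n : nat) := n.-tuple (d.-tuple R * R).

Definition count_in (R : realType) (d n : nat) (z : sample R d n)
    (V : cell R d) : nat :=
  #|[set i : 'I_n | in_cell V (tnth z i).1]%SET|.

Definition populated_splits (R : realType) (d n : nat) (z : sample R d n)
    (m : nat) (V : cell R d) : set (sr_split R d) :=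
  [set s | [/\ @all_splits R d s,
               (m <= count_in z (left_child V s))%N &
               (m <= count_in z (right_child V s))%N]].

Definition is_minimizer (R : realType) (A : Type) (f : A -> R) (D : set A)
    (a : A) : Prop :=
  D a /\ forall a', D a' -> f a <= f a'.

Definition admissible_splits (R : realType) (d n : nat) (z : sample R d n)
    (m : nat) (beta : R) (V : cell R d) : set (sr_split R d) :=
  shape_regular_splits beta V `&` populated_splits z m V.

(* One step of the construction; partitions are lists of cells. No step leaves
   a partition one of whose cells has a populated split but no cost-minimizing
   admissible one. *)
Inductive sr_step (R : realType) (d n : nat) (z : sample R d n) (m : nat)
    (beta : R) (cost : sr_split R d -> cell R d -> R) :
    seq (cell R d) -> seq (cell R d) -> Prop :=
| sr_step_nil : sr_step z m beta cost [::] [::]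
| sr_step_split V s Pi Pi' :
    populated_splits z m V !=set0 ->
    is_minimizer (cost^~ V) (admissible_splits z m beta V) s ->
    sr_step z m beta cost Pi Pi' ->
    sr_step z m beta cost (V :: Pi) [:: left_child V s, right_child V s & Pi']
| sr_step_keep V Pi Pi' :
    populated_splits z m V = set0 ->
    sr_step z m beta cost Pi Pi' ->
    sr_step z m beta cost (V :: Pi) (V :: Pi').

Inductive sr_reachable (R : realType) (d n : nat) (z : sample R d n) (m : nat)
    (beta : R) (cost : sr_split R d -> cell R d -> R) : seq (cell R d) -> Prop :=
| sr_reachable_root : sr_reachable z m beta cost [:: root_cell R d]
| sr_reachable_step Pi Pi' :
    sr_reachable z m beta cost Pi -> sr_step z m beta cost Pi Pi' ->
    sr_reachable z m beta cost Pi'.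

Definition sr_final (R : realType) (d n : nat) (z : sample R d n) (m : nat)
    (beta : R) (cost : sr_split R d -> cell R d -> R) (Pi : seq (cell R d)) :
    Prop :=
  sr_reachable z m beta cost Pi /\ sr_step z m beta cost Pi Pi.

Definition sr_minimizers_exist (R : realType) (d n : nat) (z : sample R d n)
    (m : nat) (beta : R) (cost : sr_split R d -> cell R d -> R) : Prop :=
  forall Pi V, sr_reachable z m beta cost Pi -> V \in Pi ->
    populated_splits z m V !=set0 ->
    exists s, is_minimizer (cost^~ V) (admissible_splits z m beta V) s.

(* The cell of [Pi] that contains [x]; it is unique when [Pi] is a partition of
   the unit cube and [x] is in the cube. *)
Definition local_map (R : realType) (d : nat) (Pi : seq (cell R d))
    (x : d.-tuple R) : cell R d :=
  nth (root_cell R d) Pi (find (fun V => in_cell V x) Pi).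

Definition local_average (R : realType) (d n : nat) (z : sample R d n)
    (V : cell R d) : R :=
  (\sum_(i < n | in_cell V (tnth z i).1) (tnth z i).2) / (count_in z V)%:R.

Definition lipschitz_dist2 (R : realType) (d : nat) (D : set (d.-tuple R))
    (g : d.-tuple R -> R) (c : R) : Prop :=
  forall x y, D x -> D y -> `|g x - g y| <= c * dist2 x y.

Definition lipschitz_const (R : realType) (d : nat) (g : d.-tuple R -> R)
    (V : cell R d) : R :=
  inf [set c | 0 <= c /\ lipschitz_dist2 [set x | in_cell V x] g c].

(* Main.v *)
Require Import Defs.
From HB Require Import structures.
From mathcomp Require Import all_boot all_order all_algebra.
From mathcomp Require Import all_classical all_reals all_analysis.
From mathcomp Require Import measurable_realfun ring lra.

Set Implicit Arguments.
Unset Strict Implicit.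
Unset Printing Implicit Defensive.

Import Order.TTheory GRing.Theory Num.Theory.
Import numFieldNormedType.Exports.

Local Open Scope classical_set_scope.
Local Open Scope ring_scope.

(** The error at x is at most the average noise in V(x) plus L(V(x)) times the
    diameter of V(x).

    Noise: a hyper-rectangle selects sample points by bounds on their ranks in
    each coordinate, so there are at most (n+1)^(2d) selection rules, and they see
    the X_i only through their order. That order is read off the cells of a fine
    grid as soon as no two sample points share a slab of the grid, which fails
    with small probability because f_X <= M. On each event fixing the grid cells
    of all the X_i, the selected set is deterministic, and the Chernoff bound for
    independent sub-Gaussian variables applies.

    Diameter: in the absence of ties a final cell has fewer than 2m sample points.
    If h_-(V)^d > 5m/(nb), then V contains a box of the fixed grid of mesh 1/(2n)
    whose expected number of sample points is at least 4m. There are at most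
    (2n+1)^(2d) such boxes, and a union bound shows that, outside an event of
    probability delta/4, each of them has at least 2m sample points.
    Shape regularity turns the bound on h_- into one on h_+. *)

(** * Expectation of products of independent variables *)

Section simple_functions.
Import HBNNSimple.

(** Every large enough number of terms [N] is allowed, so that finitely many simple functions can
    share one index type and [bigA_distr_bigA] applies to their product. *)
Lemma nnsfun_sum_indic (R : realType) (dS : measure_display)
    (S : measurableType dS) (f : {nnsfun S >-> R}) :
  exists N0, forall N, (N0 <= N)%N ->
    exists (v : 'I_N -> R) (A : 'I_N -> set S),
      [/\ forall j, 0 <= v j, forall j, measurable (A j) &
          forall x, f x = \sum_j v j * \1_(A j) x].
Proof.
have fR : finite_set (range f) by exact: fimfunP.
pose s := finmap.enum_fset (fset_set (range f)).
exists (size s) => N sN.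
(* Indices beyond the range of [f] are padding and carry the coefficient 0. *)
exists (fun j => if (j < size s)%N then s`_j else 0),
  (fun j => f @^-1` [set s`_j]); split.
- move=> j; case: ifPn => // js.
  have : s`_j \in s by rewrite mem_nth.
  by rewrite /s in_fset_set// inE => -[x _ <-]; exact: fun_ge0.
- by move=> j; exact: measurable_sfunP.
- move=> x; rewrite fimfunE fsbig_finite//= -/s (big_nth 0) big_mkord.
  rewrite (big_ord_widen N (fun j => s`_j * \1_(f @^-1` [set s`_j]) x))//.
  rewrite big_mkcond/=; apply: eq_bigr => j _.
  by case: ifPn => //; rewrite mul0r.
Qed.

End simple_functions.

Lemma prod_indic (R : realType) (U : Type) (J : finType) (B : J -> set U) w :
  \prod_i \1_(B i) w = \1_(\bigcap_(i in [set` [set: J]%SET]) B i) w :> R.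
Proof.
rewrite !indicE; case: (boolP (w \in \bigcap_(i in _) _)) => [|].
  rewrite inE => h; rewrite big1// => i _; rewrite indicE mem_set//.
  by apply: h => /=; rewrite inE.
move=> /negP h; apply/eqP; rewrite prodf_seq_eq0; apply/hasP; apply: contrapT => k.
apply: h; rewrite inE => i _; apply: contrapT => Bi; apply: k.
by exists i; rewrite ?mem_index_enum//= indicE memNset.
Qed.

Section independence.
Import HBNNSimple.
Context (R : realType) (dT : measure_display) (T : measurableType dT)
  (P : probability T R) (dS : measure_display) (S : measurableType dS).
Variables (J : finType) (Z : J -> {RV P >-> S}).

Lemma mutually_independent_comp (K : finType) (h : K -> J) :
  injective h -> mutually_independent Z -> mutually_independent (Z \o h).
Proof.
move=> hI iZ B A mA.
(* The events are transported along [h], with [setT] as a measurable default off its image. *)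
pose A' j := if [pick k | h k == j] is Some k then A k else setT.
have A'E k : A' (h k) = A k.
  rewrite /A'; case: pickP => [k' /eqP/hI ->//|/(_ k)]; by rewrite eqxx.
have mA' j : measurable (A' j) by rewrite /A'; case: pickP.
have := iZ (h @: B)%SET A' mA'; rewrite big_imset/=; last by move=> x y _ _; exact: hI.
under eq_bigr do rewrite A'E.
move=> <-.
congr (P _); apply/seteqP; split => w /= hw.
  by move=> j /= /imsetP[k kB ->]; rewrite A'E; exact: hw.
by move=> k kB; have := hw (h k); rewrite A'E; apply; rewrite /= imset_f.
Qed.

Hypothesis iZ : mutually_independent Z.

Lemma measurable_preimage_RV (X : {RV P >-> S}) A :
  measurable A -> measurable (X @^-1` A).
Proof. by move=> mA; rewrite -[X in measurable X]setTI; exact: measurable_funPT. Qed.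

(** Multiplying out the sums of indicators leaves one term per choice function; its integral is a
    multiple of the probability of an intersection, which independence factors. *)
Lemma integral_prod_nnsfun (f : J -> {nnsfun S >-> R}) :
  (\int[P]_w (\prod_i f i (Z i w))%:E =
   (\prod_i fine (\int[P]_w (f i (Z i w))%:E))%:E)%E.
Proof.
have /choice[N0 N0P] := fun i => nnsfun_sum_indic (f i).
pose N := (\max_i N0 i)%N.
have /choice[v /choice[A vA]] := fun i => N0P i N (leq_bigmax i).
have v0 i j : 0 <= v i j by case: (vA i).
have mA i j : measurable (A i j) by case: (vA i).
have fE i x : f i x = \sum_j v i j * \1_(A i j) x by case: (vA i).
have mind i j (c : R) : measurable_fun setT (EFin \o (fun w => c * \1_(A i j) (Z i w) : R)).
  apply/measurable_EFinP; apply: measurable_funM => //.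
  by apply: measurableT_comp; [exact: measurable_indic|exact: measurable_funPT].
have int1 i : (\int[P]_w (f i (Z i w))%:E =
    (\sum_j v i j * fine (P (Z i @^-1` A i j)))%:E)%E.
  under eq_integral do rewrite fE -sumEFin.
  rewrite ge0_integral_sum//; last 2 first.
    by move=> j; exact: mind.
    by move=> j w _; rewrite lee_fin mulr_ge0.
  rewrite -sumEFin; apply: eq_bigr => j _.
  under eq_integral do rewrite EFinM.
  rewrite ge0_integralZl//; last 2 first.
    apply/measurable_EFinP.
    by apply: measurableT_comp; [exact: measurable_indic|exact: measurable_funPT].
    by rewrite lee_fin.
  under eq_integral do rewrite -[\1_(A i j) _]/(\1_(Z i @^-1` A i j) _).
  have mZA := measurable_preimage_RV (Z i) (mA i j).
  by rewrite integral_indic// setIT EFinM fineK// fin_num_measure.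
under [in RHS]eq_bigr do rewrite int1 /=.
rewrite bigA_distr_bigA -sumEFin/=.
under eq_integral => w _.
  under eq_bigr do rewrite fE.
  rewrite bigA_distr_bigA -sumEFin/=.
  over.
have mcap (h : {ffun J -> 'I_N}) :
    measurable (\bigcap_(i in [set` [set: J]%SET]) (Z i @^-1` A i (h i))).
  by apply: fin_bigcap_measurable => // i _; exact: measurable_preimage_RV.
have prodE (h : {ffun J -> 'I_N}) w :
    (\prod_i (v i (h i) * \1_(A i (h i)) (Z i w)))%:E =
    ((\prod_i v i (h i))%:E * (\1_(\bigcap_(i in [set` [set: J]%SET])
       (Z i @^-1` A i (h i))) w)%:E)%E :> \bar R.
  by rewrite -EFinM -prod_indic -big_split.
have v'0 (h : {ffun J -> 'I_N}) : (0 <= (\prod_i v i (h i))%:E :> \bar R)%E.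
  by rewrite lee_fin prodr_ge0.
rewrite ge0_integral_sum//; last 2 first.
- move=> h; under eq_fun do rewrite prodE.
  by apply: measurable_funeM; apply/measurable_EFinP; exact: measurable_indic.
- by move=> h w _; rewrite prodE mule_ge0// lee_fin.
apply: eq_bigr => h _; under eq_integral do rewrite prodE.
rewrite ge0_integralZl//; last by apply/measurable_EFinP; exact: measurable_indic.
rewrite integral_indic// setIT.
have /= -> := iZ [set: J]%SET (fun i => mA i (h i)).
rewrite -EFinM big_split/=.
by congr (_ * _)%:E; apply: eq_bigl => i; rewrite inE.
Qed.

(** Simple functions increase to each factor, and monotone convergence passes to the limit in their
    product. The bounds [c i] are the form in which Chernoff arguments use independence; they also
    keep the integrals finite, so that [fine] is faithful. *)
Lemma integral_prod_le (phi : J -> S -> R) (c : J -> R) :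
  (forall i, measurable_fun setT (phi i)) -> (forall i x, 0 <= phi i x) ->
  (forall i, (\int[P]_w (phi i (Z i w))%:E <= (c i)%:E)%E) ->
  (\int[P]_w (\prod_i phi i (Z i w))%:E <= (\prod_i c i)%:E)%E.
Proof.
move=> mphi phi0 phic.
have mEphi i : measurable_fun setT (EFin \o phi i) by exact/measurable_EFinP.
pose f k i := nnsfun_approx measurableT (mEphi i) k.
have fcvg i x : f k i x @[k --> \oo] --> phi i x.
  have := @cvg_nnsfun_approx _ _ _ _ measurableT _ (mEphi i) _ x I.
  by rewrite /= => /(_ (fun x _ => phi0 i x)) /fine_cvg.
have fnd i x : {homo (fun k => f k i x) : k l / (k <= l)%N >-> k <= l}.
  by move=> k l kl; have /lefP := nd_nnsfun_approx measurableT (mEphi i) kl; exact.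
have f_le k i x : f k i x <= phi i x.
  have /cvg_lim <- // := fcvg i x; apply: nondecreasing_cvgn_le; first exact: fnd.
  by apply/cvg_ex; exists (phi i x); exact: fcvg.
have mf k i : measurable_fun setT (fun w => f k i (Z i w)).
  by apply: measurableT_comp; [exact: measurable_funPT|exact: measurable_funPT].
pose g k w : \bar R := (\prod_i f k i (Z i w))%:E.
have glim w : g k w @[k --> \oo] --> (\prod_i phi i (Z i w))%:E.
  apply: cvg_EFin; first exact: nearW.
  have -> : fine \o g^~ w = fun k => \prod_i f k i (Z i w) by [].
  elim: (index_enum J) => [|i s IHs].
    by under eq_fun do rewrite big_nil; rewrite big_nil; exact: cvg_cst.
  under eq_fun do rewrite big_cons; rewrite big_cons.
  by apply: cvgM => //; exact: fcvg.
have := @cvg_monotone_convergence _ _ _ P setT measurableT g.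
have limE : (\int[P]_w (limn (g^~ w)) = \int[P]_w (\prod_i phi i (Z i w))%:E)%E.
  by apply: eq_integral => w _; apply/cvg_lim => //; exact: glim.
rewrite limE => gint.
have {}gint : (\int[P]_w g k w)%E @[k --> \oo] --> (\int[P]_w (\prod_i phi i (Z i w))%:E)%E.
  apply: gint.
  - by move=> k; apply/measurable_EFinP; apply: measurable_prod => i _; exact: mf.
  - by move=> k w _; rewrite lee_fin prodr_ge0// => i _; exact: fun_ge0.
  - move=> w _ k l kl; rewrite lee_fin; apply: ler_prod => i _.
    by rewrite fun_ge0/= fnd.
have /cvg_lim <- // := gint.
apply: lime_le; first by apply/cvg_ex; eexists; exact: gint.
apply: nearW => k; rewrite /g integral_prod_nnsfun lee_fin.
apply: ler_prod => i _.
have int0 : (0 <= \int[P]_w (f k i (Z i w))%:E)%E.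
  by apply: integral_ge0 => w _; rewrite lee_fin fun_ge0.
have intc : (\int[P]_w (f k i (Z i w))%:E <= (c i)%:E)%E.
  apply: le_trans (phic i); apply: ge0_le_integral => //.
  - by move=> w _; rewrite lee_fin fun_ge0.
  - by apply/measurable_EFinP; exact: mf.
  - by apply/measurable_EFinP; apply: measurableT_comp => //; exact: measurable_funPT.
  - by move=> w _; rewrite lee_fin; exact: f_le.
by rewrite fine_ge0//= -lee_fin fineK// ge0_fin_numE// (le_lt_trans intc)// ltry.
Qed.

End independence.

(** * Boxes under the density *)

Definition box (R : realType) (d : nat) (lo hi : 'I_d -> R) : set (d.-tuple R) :=
  [set x | forall k, lo k <= tnth x k <= hi k].

Lemma measurable_coordinate_preimage (R : realType) (d : nat) (k : 'I_d) (A : set R) :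
  measurable A -> measurable [set x : d.-tuple R | A (tnth x k)].
Proof.
move=> mA; rewrite -[X in measurable X]setTI.
exact: (measurable_tnth k measurableT mA).
Qed.

Lemma measurable_box (R : realType) (d : nat) (lo hi : 'I_d -> R) :
  measurable (box lo hi).
Proof.
have -> : box lo hi =
    \bigcap_(k in [set: 'I_d]) [set x | `[lo k, hi k]%classic (tnth x k)].
  apply/seteqP; split => x h k; have := h k; rewrite /= in_itv//=; exact.
apply: fin_bigcap_measurable => // k _.
exact: (measurable_coordinate_preimage _ (measurable_itv _)).
Qed.

Lemma lebesgue_vec_box (R : realType) (d : nat) (lo hi : 'I_d -> R) :
  (forall k, lo k <= hi k) ->
  lebesgue_vec R d (box lo hi) = (\prod_k (hi k - lo k))%:E.
Proof.
elim: d lo hi => [|d IHd] lo hi lohi.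
  rewrite big_ord0 /= diracE mem_set//; by case.
rewrite /= /push_cons /pushforward.
have -> : (fun xt : d.-tuple R * R => [tuple of xt.2 :: xt.1]) @^-1` box lo hi =
   box (lo \o lift ord0) (hi \o lift ord0) `*` `[lo ord0, hi ord0]%classic.
  apply/seteqP; split => [[x t] /= h|[x t] /= [hx ht] k].
    split => [k|]; first by have := h (lift ord0 k); rewrite tnthS.
    by have := h ord0; rewrite in_itv/= tnth0.
  case: (unliftP ord0 k) => [j|] ->; first by rewrite tnthS; exact: hx.
  by rewrite tnth0; move: ht; rewrite in_itv.
rewrite product_measure1E//; last exact: measurable_box.
rewrite IHd; last by move=> k; exact: lohi.
rewrite [X in (_ * X)%E](lebesgue_measure_itv `[lo ord0, hi ord0])/= lte_fin big_ord_recl.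
(* The length formula tests whether the end points are strictly ordered; for a degenerate side both
   products vanish. *)
have := lohi ord0; rewrite le_eqVlt => /orP[/eqP e|->]; last by rewrite muleC.
by rewrite e ltxx subrr mul0r mule0.
Qed.

Lemma unit_cube_box (R : realType) (d : nat) :
  @unit_cube R d = box (fun=> 0) (fun=> 1).
Proof. by []. Qed.

Section density.
Context (R : realType) (dT : measure_display) (T : measurableType dT)
  (P : probability T R) (d : nat).
Variables (X : T -> d.-tuple R) (f : d.-tuple R -> R) (b M : R).
Hypotheses (b0 : 0 < b) (M0 : 0 < M) (Xf : has_density_on_cube P X f)
  (fbM : forall x, @unit_cube R d x -> b <= f x <= M).

Let integral_density (A : set (d.-tuple R)) (c : R) : measurable A ->
  0 < c -> (\int[lebesgue_vec R d]_(x in A `&` @unit_cube R d) c%:E =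
    c%:E * lebesgue_vec R d (A `&` @unit_cube R d))%E.
Proof.
move=> mA c0; rewrite integral_cst//.
by apply: measurableI => //; rewrite unit_cube_box; exact: measurable_box.
Qed.

Let mcube : measurable (@unit_cube R d).
Proof. by rewrite unit_cube_box; exact: measurable_box. Qed.

Let mf (A : set (d.-tuple R)) : measurable A ->
  measurable_fun (A `&` @unit_cube R d) (EFin \o f).
Proof.
move=> mA; apply/measurable_EFinP.
by apply: measurable_funS (proj1 Xf) => //; exact: subIsetr.
Qed.

Lemma density_ge (A : set (d.-tuple R)) : measurable A ->
  (b%:E * lebesgue_vec R d (A `&` @unit_cube R d) <= P (X @^-1` A))%E.
Proof.
move=> mA; rewrite -integral_density// (proj2 Xf)//.
apply: ge0_le_integral => //.
- exact: measurableI.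
- by move=> x _; rewrite lee_fin ltW.
- exact: mf.
- by move=> x [_ /fbM/andP[]].
Qed.

Lemma density_le (A : set (d.-tuple R)) : measurable A ->
  (P (X @^-1` A) <= M%:E * lebesgue_vec R d (A `&` @unit_cube R d))%E.
Proof.
move=> mA; rewrite -integral_density// (proj2 Xf)//.
apply: ge0_le_integral => //.
- exact: measurableI.
- by move=> x [_ /fbM/andP[/(le_trans (ltW b0))]].
- exact: mf.
- by move=> x [_ /fbM/andP[]].
Qed.

Lemma density_box_ge (lo hi : 'I_d -> R) :
  (forall k, [/\ 0 <= lo k, lo k <= hi k & hi k <= 1]) ->
  ((b * \prod_k (hi k - lo k))%:E <= P (X @^-1` box lo hi))%E.
Proof.
move=> lh; rewrite EFinM -lebesgue_vec_box; last by move=> k; case: (lh k).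
rewrite -[in leLHS](_ : box lo hi `&` @unit_cube R d = box lo hi).
  by apply: density_ge; exact: measurable_box.
rewrite setIidl// => x hx k; have [l0 _ h1] := lh k; have /andP[lx xh] := hx k.
by rewrite (le_trans l0)//= (le_trans xh).
Qed.

(** Within the cube the slab is contained in a box with side $[s,t]$ in direction [k] and $[0,1]$ in
    the others. The inclusion is asked on $[0,1]$ only, because the extreme levels of the grid also
    collect the coordinates outside it. *)
Lemma density_slab_le (k : 'I_d) (A : set R) (s t : R) : measurable A ->
  s <= t -> A `&` `[0, 1] `<=` `[s, t] ->
  (P (X @^-1` [set x | A (tnth x k)]) <= (M * (t - s))%:E)%E.
Proof.
move=> mA st Ast.
pose lo k' := if k' == k then s else 0; pose hi k' := if k' == k then t else 1.
have -> : M * (t - s) = M * \prod_k' (hi k' - lo k').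
  rewrite (bigD1 k)//= big1 => [|k' /negbTE k'k]; last first.
    by rewrite /hi /lo k'k subr0.
  by rewrite mulr1 /hi /lo eqxx.
have mA' := measurable_coordinate_preimage k mA.
rewrite EFinM -lebesgue_vec_box; last first.
  by move=> k'; rewrite /lo /hi; case: ifP.
apply: (le_trans (density_le _)) => //.
rewrite lee_pmul2l ?lte_fin//.
apply: le_measure; rewrite ?inE//; [exact: measurableI|exact: measurable_box|].
move=> x [/= Ax xc] k'; rewrite /lo /hi; case: ifP => [/eqP ->|_]; last exact: xc.
have : (A `&` `[0, 1]) (tnth x k) by split => //; rewrite /= in_itv; exact: xc.
by move=> /Ast; rewrite /= in_itv.
Qed.

(** [has_density_on_cube] integrates over the cube whatever the event, so the cube and the whole
    space have the same probability. *)
Lemma density_cube_eq1 : P (X @^-1` @unit_cube R d) = 1%E.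
Proof.
rewrite (proj2 Xf)// setIid -[RHS](@probability_setT _ _ _ P).
by rewrite -[setT](preimage_setT X) (proj2 Xf)// setTI.
Qed.

End density.

(** * Deviation bounds *)

Section probability_bounds.
Context (R : realType) (dT : measure_display) (T : measurableType dT)
  (P : probability T R).

Lemma probability_finite_union (I : finType) (F : I -> set T) (a : I -> R) :
  (forall i, measurable (F i)) -> (forall i, (P (F i) <= (a i)%:E)%E) ->
  measurable (\bigcup_i F i) /\ (P (\bigcup_i F i) <= (\sum_i a i)%:E)%E.
Proof.
move=> mF PF; have -> : \bigcup_i F i = \big[setU/set0]_i F i.
  rewrite -(bigcup_seq (index_enum I)); apply/seteqP; split => w [i _ Fi].
    by exists i => //=; exact: mem_index_enum.
  by exists i.
elim: (index_enum I) => [|i s [mU PU]].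
  by rewrite !big_nil measure0; split.
rewrite !big_cons; split; first exact: measurableU.
rewrite EFinD; apply: (le_trans (measureU2 P (mF i) mU)).
exact: (leeD (PF i) PU).
Qed.

Lemma markov_ge (A : set T) (f : T -> R) (c : R) :
  measurable A -> measurable_fun setT f -> (forall w, 0 <= f w) -> 0 <= c ->
  (forall w, A w -> c <= f w) ->
  (c%:E * P A <= \int[P]_w (f w)%:E)%E.
Proof.
move=> mA mf f0 c0 Af.
rewrite -[A in leLHS]setIT -integral_indic// -ge0_integralZl//; last first.
  by apply/measurable_EFinP; exact: measurable_indic.
apply: ge0_le_integral => //.
- by move=> w _; rewrite -EFinM lee_fin mulr_ge0.
- by apply: measurable_funeM; apply/measurable_EFinP; exact: measurable_indic.
- exact/measurable_EFinP.
- move=> w _; rewrite -EFinM lee_fin indicE.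
  by case: (boolP (w \in A)) => [|_]; rewrite ?inE ?mulr1 ?mulr0//; exact: Af.
Qed.

(** A Chernoff bound with a fixed base: by independence the expectation of $2^{-\mathrm{count}}$ is
    at most a product of factors $1-p/2\le e^{-p/2}$. *)
Lemma binomial_lower_tail (dS : measure_display) (S : measurableType dS)
    (n : nat) (Z : 'I_n -> {RV P >-> S}) (W : set S) (p : R) (k : nat) :
  mutually_independent Z -> measurable W ->
  (forall i, P (Z i @^-1` W) = p%:E) ->
  measurable [set w | (#|[set i | `[< W (Z i w) >]]%SET| <= k)%N] /\
  (P [set w | (#|[set i | `[< W (Z i w) >]]%SET| <= k)%N] <=
    (2 ^+ k * expR (- (n%:R * p / 2)))%:E)%E.
Proof.
move=> iZ mW PW.
(* This is 2 to the power minus the indicator of [W], written affinely so that it can be integrated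
   by linearity. *)
pose phi (x : S) : R := 1 - 2^-1 * \1_W x.
have phiE x : phi x = if `[< W x >] then 2^-1 else 1.
  rewrite /phi indicE; have [Wx|Wx] := pselect (W x).
    by rewrite mem_set// asboolT// mulr1; lra.
  by rewrite memNset// asboolF// mulr0 subr0.
have mphi : measurable_fun setT phi.
  by apply: measurable_funB => //; apply: measurable_funM.
have phi0 x : 0 <= phi x by rewrite phiE; case: ifP; lra.
have prodE w : \prod_i phi (Z i w) = 2^-1 ^+ #|[set i | `[< W (Z i w) >]]%SET|.
  under eq_bigr do rewrite phiE.
  rewrite -big_mkcond/= prodr_const; congr (_ ^+ _).
  by rewrite cardsE.
have mprod : measurable_fun setT (fun w => \prod_i phi (Z i w)).
  by apply: measurable_prod => i _; apply: measurableT_comp.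
have half : 0 < 2^-1 :> R by rewrite invr_gt0.
have half1 : 2^-1 < 1 :> R by rewrite invf_lt1// ltr1n.
(* A count is at most [k] iff $2^{-\mathrm{count}}\ge 2^{-k}$; this gives both measurability and the
   form required by Markov's inequality. *)
have setE : [set w | (#|[set i | `[< W (Z i w) >]]%SET| <= k)%N] =
    (fun w => \prod_i phi (Z i w)) @^-1` `[2^-1 ^+ k, +oo[%classic.
  apply/seteqP; split => w /=; rewrite in_itv/= andbT prodE.
    by move=> h; apply: ler_wiXn2l => //; lra.
  move=> h; rewrite leqNgt; apply/negP => kh.
  by move: h; rewrite leNgt ltr_iXn2l// kh.
have mA : measurable [set w | (#|[set i | `[< W (Z i w) >]]%SET| <= k)%N].
  rewrite setE -[X in measurable X]setTI; apply: mprod => //.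
split => //.
have mZ i : measurable_fun setT (fun w => \1_W (Z i w) : R).
  by apply: measurableT_comp; [exact: measurable_indic|exact: measurable_funPT].
have int_phi i : (\int[P]_w (phi (Z i w))%:E <= (expR (- (p / 2)))%:E)%E.
  under eq_integral do rewrite EFinB.
  rewrite integralB//; last 2 first.
  - exact: finite_measure_integrable_cst.
  - under eq_fun do rewrite EFinM.
    apply: integrableZl => //.
    rewrite -[X in _.-integrable _ X]/(EFin \o \1_(Z i @^-1` W)).
    by apply: integrable_indic; exact: measurable_preimage_RV.
  have -> : (\int[P]_w 1%:E = 1)%E.
    by rewrite integral_cst// mul1e; exact: probability_setT.
  under eq_integral do rewrite EFinM.
  rewrite ge0_integralZl//; last exact/measurable_EFinP.
  under eq_integral do rewrite -[\1_W _]/(\1_(Z i @^-1` W) _).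
  rewrite integral_indic ?setIT//; last exact: measurable_preimage_RV.
  rewrite [X in (_ * X)%E]PW -EFinM -EFinB lee_fin.
  by apply: le_trans (expR_ge1Dx _); rewrite (mulrC p).
have := integral_prod_le iZ (fun=> mphi) (fun=> phi0) int_phi.
(* Markov inequality for the expectation of [2 ^ - count] *)
have prod0 w : 0 <= \prod_i phi (Z i w) by apply: prodr_ge0.
have := markov_ge mA mprod prod0 (exprn_ge0 k (ltW half)).
move=> markov int_prod.
have {markov}int_prod := le_trans (markov _) int_prod.
have -> : 2 ^+ k * expR (- (n%:R * p / 2)) =
    (2^-1 ^+ k)^-1 * \prod_(i < n) expR (- (p / 2)).
  rewrite exprVn invrK prodr_const card_ord -expRM_natl.
  by congr (_ * expR _); lra.
rewrite EFinM lee_pdivlMl ?exprn_gt0//.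
apply: int_prod => w; rewrite setE /= in_itv/= andbT; exact.
Qed.
End probability_bounds.

(** * Sub-Gaussian noise summed over a random selection *)

Section noise.
Context (R : realType) (dT : measure_display) (T : measurableType dT)
  (P : probability T R) (dU : measure_display) (U : measurableType dU).
Variables (n : nat) (Z : {RV P >-> (U * R)%type})
  (Zs : 'I_n -> {RV P >-> (U * R)%type}) (g : U -> R) (v : R).
Variables (C : finType) (code : U -> C).
Hypotheses (v0 : 0 <= v) (iZ : mutually_independent Zs)
  (idZ : forall i (A : set (U * R)), measurable A ->
    distribution P (Zs i) A = distribution P Z A)
  (mg : measurable_fun setT g)
  (subg : cond_subgaussian P (fun w => (Z w).1) (fun w => (Z w).2 - g (Z w).1) v)
  (mcode : forall c, measurable (code @^-1` [set c])).

Let noise (x : U * R) : R := x.2 - g x.1.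

Let mnoise : measurable_fun setT noise.
Proof.
by apply: measurable_funB => //; apply: measurableT_comp.
Qed.

Let p c : R := fine (P ((fun w => (Z w).1) @^-1` (code @^-1` [set c]))).

Let mfst (A : set U) (W : {RV P >-> (U * R)%type}) : measurable A ->
  measurable ((fun w => (W w).1) @^-1` A).
Proof.
move=> mA; rewrite -[X in measurable X]setTI.
have : measurable_fun setT (fun w => (W w).1) by exact: measurableT_comp.
exact.
Qed.

Let pE c : (p c)%:E = P ((fun w => (Z w).1) @^-1` (code @^-1` [set c])).
Proof. by rewrite fineK// fin_num_measure//; exact: mfst. Qed.

Let p0 c : 0 <= p c.
Proof. by rewrite -lee_fin pE. Qed.

Let sum_p : \sum_c p c = 1.
Proof.
apply: EFin_inj; rewrite -sumEFin.
transitivity (\sum_c \int[P]_w (\1_((fun w => (Z w).1) @^-1` (code @^-1` [set c])) w)%:E)%E.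
  by apply: eq_bigr => c _; rewrite integral_indic ?setIT//; exact: mfst.
rewrite -ge0_integral_sum//; last first.
  move=> c; apply/measurable_EFinP; apply: measurable_indic; exact: mfst.
rewrite -[RHS](@probability_setT _ _ _ P) -[RHS]mul1e -integral_cst//.
apply: eq_integral => w _; rewrite sumEFin; congr EFin.
rewrite (bigD1 (code (Z w).1))//= indicE mem_set// big1 ?addr0// => c cZ.
by rewrite indicE memNset//= => /eqP; rewrite eq_sym; exact/negP.
Qed.

Let integral_indicM (B : set T) (F : T -> R) :
  (\int[P]_w (\1_B w * F w)%:E = \int[P]_(w in B) (F w)%:E)%E.
Proof.
rewrite [RHS]integral_mkcond; apply: eq_integral => w _.
by rewrite /patch indicE; case: ifP => _; rewrite ?mul1r ?mul0r.
Qed.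

Let identical_integral (i : 'I_n) (F : U * R -> R) :
  measurable_fun setT F -> (forall x, 0 <= F x) ->
  (\int[P]_w (F (Zs i w))%:E = \int[P]_w (F (Z w))%:E)%E.
Proof.
move=> mF F0; transitivity (\int[distribution P (Zs i)]_x (F x)%:E)%E.
  by rewrite ge0_integral_distribution//; exact/measurable_EFinP.
transitivity (\int[distribution P Z]_x (F x)%:E)%E.
  by apply: eq_measure_integral => A mA _; exact: idZ.
by rewrite ge0_integral_distribution//; exact/measurable_EFinP.
Qed.

(** The exponential weight of one observation, restricted to a fibre of [code]. Prescribing the
    codes of all observations is again a product of such restrictions, so independence still factors
    the expectation. *)
Let tilted c (s : R) (x : U * R) : R :=
  \1_(code @^-1` [set c]) x.1 * expR (s * noise x).

Let mtilted c s : measurable_fun setT (tilted c s).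
Proof.
apply: measurable_funM; last by apply: measurableT_comp => //; apply: measurable_funM.
by apply: measurableT_comp => //; exact: measurable_indic.
Qed.

Let tilted_ge0 c s x : 0 <= tilted c s x.
Proof. by rewrite mulr_ge0// expR_ge0. Qed.

(** A fibre of [code] is an event about the covariate alone, so the conditional moment generating
    function may be integrated over it. *)
Let integral_tilted_le c s i :
  (\int[P]_w (tilted c s (Zs i w))%:E <= (expR (s ^+ 2 * v / 2) * p c)%:E)%E.
Proof.
rewrite identical_integral// /tilted.
pose B := (fun w => (Z w).1) @^-1` (code @^-1` [set c]).
have mB : measurable B by exact: mfst.
under eq_integral do rewrite -[\1_(code @^-1` _) _]/(\1_B _).
rewrite integral_indicM.
have [_ /(_ s) [h [[ieps mh ih hE] [N [mN PN hN]]]]] := subg.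
have {}hE : (\int[P]_(w in B) (expR (s * noise (Z w)))%:E =
  \int[P]_(w in B) (h (Z w).1)%:E)%E by exact: hE.
have ihB : P.-integrable B (fun w => (h (Z w).1)%:E).
  exact: (integrableS measurableT).
rewrite hE (negligible_integral mN)//.
(* The bound on [h] holds off the null set [N], which is removed from the domain. *)
have mBN : measurable (B `\` N) by exact: measurableD.
apply: (@le_trans _ _ (\int[P]_(w in B `\` N) (expR (s ^+ 2 * v / 2))%:E)%E).
  apply: le_integral => //.
  - exact: (integrableS measurableT).
  - exact: finite_measure_integrable_cst.
  - move=> w; rewrite inE => -[_ Nw]; rewrite lee_fin.
    by apply: contrapT => hw; apply: Nw; exact: hN.
rewrite integral_cst// EFinM pE; apply: lee_wpmul2l; first by rewrite lee_fin expR_ge0.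
by apply: le_measure; rewrite ?inE//; exact: subDsetl.
Qed.

Let codes w := [ffun i => code (Zs i w).1].

Let selected_sum (sg : R) (A : {set 'I_n}) w := sg * \sum_(i in A) noise (Zs i w).

Let mselected_sum sg A : measurable_fun setT (selected_sum sg A).
Proof.
apply: measurable_funM => //; under eq_fun do rewrite -big_enum/=.
by apply: measurable_sum => i; exact: measurableT_comp.
Qed.

Let mcodes c : measurable [set w | codes w = c].
Proof.
have -> : [set w | codes w = c] =
    \bigcap_(i in [set: 'I_n]) ((fun w => (Zs i w).1) @^-1` (code @^-1` [set c i])).
  apply/seteqP; split => w /= h.
    by move=> i _ /=; rewrite -h ffunE.
  by apply/ffunP => i; rewrite ffunE; exact: h.
by apply: fin_bigcap_measurable => // i _; exact: mfst.
Qed.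

Let tail_event sg c A t := [set w | codes w = c] `&` [set w | t <= selected_sum sg A w].

Let mtail_event sg c A t : measurable (tail_event sg c A t).
Proof.
apply: measurableI => //.
have -> : [set w | t <= selected_sum sg A w] =
    selected_sum sg A @^-1` `[t, +oo[%classic.
  by apply/seteqP; split => w; rewrite /= in_itv/= andbT.
by rewrite -[X in measurable X]setTI; exact: mselected_sum.
Qed.

Let mstrict_tail sg c A t :
  measurable ([set w | codes w = c] `&` [set w | t < selected_sum sg A w]).
Proof.
apply: measurableI => //.
have -> : [set w | t < selected_sum sg A w] = selected_sum sg A @^-1` `]t, +oo[%classic.
  by apply/seteqP; split => w; rewrite /= in_itv/= andbT.
by rewrite -[X in measurable X]setTI; exact: mselected_sum.
Qed.

Let chernoff sg c A s t : (sg ^+ 2 = 1) -> 0 <= s ->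
  (P (tail_event sg c A t) <=
   (expR (- (s * t) + s ^+ 2 * (v * #|A|%:R) / 2) * \prod_i p (c i))%:E)%E.
Proof.
move=> sg1 s0.
(* Unselected observations get exponent 0 and contribute only the probability of their fibre; the
   sign [sg] selects the upper or the lower tail. *)
pose s_ i := if i \in A then s * sg else 0.
have := integral_prod_le iZ (fun i => mtilted (c i) (s_ i))
  (fun i => tilted_ge0 (c i) (s_ i)) (fun i => integral_tilted_le (c i) (s_ i) i).
have -> : \prod_i (expR (s_ i ^+ 2 * v / 2) * p (c i)) =
    expR (s ^+ 2 * (v * #|A|%:R) / 2) * \prod_i p (c i).
  rewrite big_split/= -expR_sum; congr (expR _ * _).
  rewrite -sumr_const -[RHS]mulrA mulr_sumr mulr_suml mulr_sumr [RHS]big_mkcond/=.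
  apply: eq_bigr => i _; rewrite /s_; case: ifP => _; last by rewrite expr0n/= !mul0r.
  by rewrite exprMn sg1; lra.
set F := fun w => \prod_i tilted (c i) (s_ i) (Zs i w).
have mF : measurable_fun setT F by apply: measurable_prod => i _; exact: measurableT_comp.
have F0 w : 0 <= F w by apply: prodr_ge0.
have FE w : codes w = c -> F w = expR (s * selected_sum sg A w).
  move=> wc; rewrite /F /tilted.
  under eq_bigr => i _.
    rewrite indicE mem_set/=; last by rewrite -wc ffunE.
    rewrite mul1r; over.
  rewrite -expR_sum; congr expR; rewrite /selected_sum mulrA mulr_sumr [RHS]big_mkcond/=.
  by apply: eq_bigr => i _; rewrite /s_; case: ifP => _; rewrite ?mul0r.
have := markov_ge P (mtail_event sg c A t) mF F0 (expR_ge0 (s * t)).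
move=> markov int_F; have {markov}int_F := le_trans (markov _) int_F.
rewrite expRD expRN -mulrA EFinM lee_pdivlMl ?expR_gt0//.
by apply: int_F => w [/FE -> tw]; rewrite ler_expR ler_wpM2l.
Qed.

Let tail_cell sg c (A : {set 'I_n}) l : (sg ^+ 2 = 1) -> 0 <= l ->
  (P ([set w | codes w = c] `&`
      [set w | (Num.sqrt (2 * v * #|A|%:R * l) < selected_sum sg A w)%R]) <=
   (expR (- l) * \prod_i p (c i))%:E)%E.
Proof.
move=> sg1 l0; set t := Num.sqrt _.
have vA0 : 0 <= v * #|A|%:R by rewrite mulr_ge0.
have t0 : 0 <= t by exact: sqrtr_ge0.
have t2 : t ^+ 2 = 2 * (v * #|A|%:R) * l by rewrite sqr_sqrtr ?mulr_ge0// !mulrA.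
have [vA|vA] := eqVneq (v * #|A|%:R) 0; last first.
  have {}vA0 : 0 < v * #|A|%:R by rewrite lt_neqAle eq_sym vA.
  apply: (@le_trans _ _ (P (tail_event sg c A t))).
    apply: le_measure; rewrite ?inE//.
    by move=> w [wc /= /ltW]; split.
  (* The exponent $s=t/(v|A|)$ minimizes $-st+s^2v|A|/2$, and the minimum is $-t^2/(2v|A|)=-l$. *)
  apply: (le_trans (chernoff c A t sg1 (divr_ge0 t0 (ltW vA0)))).
  rewrite lee_fin ler_wpM2r ?prodr_ge0// ler_expR.
  have VE (V : R) : V != 0 -> t ^+ 2 = 2 * V * l ->
      - (t / V * t) + (t / V) ^+ 2 * V / 2 = - l.
    move=> V0 tV; have -> : - (t / V * t) + (t / V) ^+ 2 * V / 2 = - (t ^+ 2 / V / 2) by field.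
    by rewrite tV; field.
  by rewrite (VE _ vA t2).
(* For [v * #|A| = 0] no exponent is optimal: let it tend to infinity on the
   events [1 / (k + 1) <= sum]. *)
rewrite [t](_ : _ = 0); last by rewrite /t -(mulrA 2) vA mulr0 mul0r sqrtr0.
have -> : [set w | codes w = c] `&` [set w | 0 < selected_sum sg A w] =
    \bigcup_k tail_event sg c A k.+1%:R^-1.
  apply/seteqP; split => [w [wc /= S0]|w [k _ [wc /= /lt_le_trans S0]]].
    have [k kS] := ltr_add_invr S0.
    by exists k => //; split => //=; rewrite -[_^-1]add0r ltW.
  by split => //=; apply: S0; rewrite invr_gt0.
have mU : measurable (\bigcup_k tail_event sg c A k.+1%:R^-1).
  exact: bigcupT_measurable.
have nd : {homo (fun k => tail_event sg c A k.+1%:R^-1) : k l / (k <= l)%N >-> (k <= l)%O}.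
  move=> k k' kk'; apply/subsetPset => w [wc /= kw]; split => //=.
  by apply: le_trans kw; rewrite lef_pV2 ?posrE// ler_nat ltnS.
apply: (cvge_le _ (nondecreasing_cvg_mu (mu := P)
  (fun k => mtail_event sg c A k.+1%:R^-1) mU nd)).
(* At threshold $t=1/(k+1)$ the exponent $s=(k+1)l$ gives $st=l$, and the quadratic term is 0. *)
apply: nearW => k /=; have kl0 : 0 <= k.+1%:R * l by rewrite mulr_ge0.
apply: (le_trans (chernoff c A k.+1%:R^-1 sg1 kl0)).
rewrite vA mulr0 mul0r addr0 lee_fin.
by rewrite [k.+1%:R * l]mulrC mulfK.
Qed.

(* The selected set is random, but it is constant on each event [codes w = c]. *)
Lemma selected_noise_tail (sel : {ffun 'I_n -> C} -> {set 'I_n}) (sg l : R) :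
  sg ^+ 2 = 1 -> 0 <= l ->
  let sel' w := sel [ffun i => code (Zs i w).1] in
  let B := [set w | Num.sqrt (2 * v * #|sel' w|%:R * l) <
     sg * \sum_(i in sel' w) ((Zs i w).2 - g (Zs i w).1)] in
  measurable B /\ (P B <= (expR (- l))%:E)%E.
Proof.
move=> sg1 l0 sel' B.
pose D (c : {ffun 'I_n -> C}) := [set w | codes w = c] `&`
  [set w | Num.sqrt (2 * v * #|sel c|%:R * l) < selected_sum sg (sel c) w].
have -> : B = \bigcup_c D c.
  apply/seteqP; split => [w Bw|w [c _ [/= wc Dw]]]; first by exists (codes w).
  by rewrite /B/= /sel' -/(codes w) wc.
have [mU PU] := probability_finite_union (P := P)
  (fun c => mstrict_tail sg c (sel c) (Num.sqrt (2 * v * #|sel c|%:R * l)))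
  (fun c => tail_cell c (sel c) sg1 l0).
split => //; apply: (le_trans PU).
(* Fixing the codes costs nothing in the union bound: the products of fibre probabilities add up to
   $(\sum_c p_c)^n=1$. *)
by rewrite -mulr_sumr -(bigA_distr_bigA (fun (i : 'I_n) c => p c))/= sum_p big1 ?mulr1.
Qed.

End noise.

(** * Cells of the tree *)

(** The smallest remaining element is moved to [B], [m] times; injectivity of [f] makes the
    separation strict. *)
Lemma ex_lower_subset (R : realType) (I : finType) (f : I -> R) (A : {set I}) (m : nat) :
  {in A &, injective f} -> (m <= #|A|)%N ->
  exists B : {set I}, [/\ B \subset A, #|B| = m &
    forall i j, i \in B -> j \in (A :\: B)%SET -> f i < f j].
Proof.
move=> fI; elim: m => [_|m IHm mA].
  by exists finset.set0; split; rewrite ?finset.sub0set ?cards0// => i j; rewrite inE.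
have [B [BA Bm Bf]] := IHm (ltnW mA).
have : (0 < #|(A :\: B)%SET|)%N by rewrite cardsD (finset.setIidPr BA) Bm subn_gt0.
move=> /card_gt0P[i0 Ai0].
case: (arg_minP f Ai0) => i iAB imin.
exists (i |: B)%SET; split.
- by rewrite finset.subUset BA andbT finset.sub1set; case/setDP: iAB.
- by rewrite cardsU1; case/setDP: iAB => _ ->; rewrite Bm.
- move=> j k; rewrite !inE negb_or => /orP[/eqP ->{j}|jB] /andP[/andP[ki kB] kA].
    have kAB : k \in (A :\: B)%SET by rewrite inE kB.
    rewrite lt_neqAle imin// andbT.
    apply: contraNneq ki => fik; apply/eqP/fI => //; by case/setDP: iAB.
  by apply: Bf; rewrite ?inE ?kB.
Qed.

Section cells.
Context (R : realType) (d : nat).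
Implicit Types (V : cell R d) (x : d.-tuple R) (s : sr_split R d).

(** The end types [bl] and [br] are left free because cuts change them. The strict inequality keeps
    side lengths positive. *)
Definition subcube V := forall k, exists bl lo br hi,
  [/\ V k = Interval (BSide bl lo) (BSide br hi), 0 <= lo, lo < hi & hi <= 1].

(** Each side is sandwiched between the open and the closed interval with the same ends, which
    spares later arguments the case analysis on end types. *)
Lemma subcube_itv V k : subcube V ->
  [/\ 0 <= itv_lo (V k), itv_lo (V k) < itv_hi (V k), itv_hi (V k) <= 1,
      forall y, y \in V k -> itv_lo (V k) <= y <= itv_hi (V k) &
      forall y, itv_lo (V k) < y < itv_hi (V k) -> y \in V k].
Proof.
move=> /(_ k)[bl [lo [br [hi [-> l0 lh h1]]]]]; split => //= y.
  rewrite itv_boundlr/= !lteBSide/=.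
  by case: bl; case: br => /= /andP[? ?]; apply/andP; split; lra.
move=> /andP[ly yh]; rewrite itv_boundlr/= !lteBSide/=.
by case: bl; case: br; rewrite /= ?ly ?yh ?(ltW ly) ?(ltW yh).
Qed.

Lemma side_length_bounds V k : subcube V -> 0 < side_length V k <= 1.
Proof. by move=> /(subcube_itv k)[*]; rewrite /side_length; apply/andP; lra. Qed.

Lemma cut_point_bounds V s : subcube V -> all_splits s ->
  itv_lo (V s.1) < cut_point V s < itv_hi (V s.1).
Proof.
move=> /(subcube_itv s.1)[_ lh _ _ _] /andP[u0 u1]; rewrite /cut_point /side_length.
have w0 : 0 < itv_hi (V s.1) - itv_lo (V s.1) by rewrite subr_gt0.
rewrite ltrDl mulr_gt0//= addrC -ltrBrDr.
by rewrite -[ltRHS]mul1r ltr_pM2r.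
Qed.

Lemma subcube_left_child V s : subcube V -> all_splits s -> subcube (left_child V s).
Proof.
move=> cV sS k; rewrite ffunE; case: eqP => [->|_]; last exact: cV.
have := cut_point_bounds cV sS.
have [bl [lo [br [hi [-> l0 lh h1]]]]] := cV s.1 => /= /andP[ct1 ct2].
by exists bl, lo, true, (cut_point V s); split=> //; apply: le_trans h1; exact: ltW.
Qed.

Lemma subcube_right_child V s : subcube V -> all_splits s -> subcube (right_child V s).
Proof.
move=> cV sS k; rewrite ffunE; case: eqP => [->|_]; last exact: cV.
have := cut_point_bounds cV sS.
have [bl [lo [br [hi [-> l0 lh h1]]]]] := cV s.1 => /= /andP[ct1 ct2].
by exists true, (cut_point V s), br, hi; split=> //; apply: le_trans (ltW ct1).
Qed.

Lemma in_left_child V s x : in_cell V x -> tnth x s.1 < cut_point V s ->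
  in_cell (left_child V s) x.
Proof.
move=> /forallP xV xs; apply/forallP => k; rewrite ffunE.
case: eqP => [e|_]; last exact: xV.
have := xV k; rewrite e; case: (V s.1) => a b; rewrite !itv_boundlr => /andP[-> _].
by rewrite /= lteBSide/= .
Qed.

Lemma in_right_child V s x : in_cell V x -> cut_point V s <= tnth x s.1 ->
  in_cell (right_child V s) x.
Proof.
move=> /forallP xV xs; apply/forallP => k; rewrite ffunE.
case: eqP => [e|_]; last exact: xV.
have := xV k; rewrite e; case: (V s.1) => a b; rewrite !itv_boundlr => /andP[_ ->].
by rewrite andbT /= lteBSide/=.
Qed.

Lemma subcube_root : subcube (root_cell R d).
Proof. by move=> k; exists true, 0, false, 1; rewrite ffunE; split. Qed.

Lemma in_root_cell x : in_cell (root_cell R d) x <-> unit_cube x.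
Proof.
split => [/forallP h k|h]; first by have := h k; rewrite ffunE in_itv.
by apply/forallP => k; rewrite ffunE in_itv/=; exact: h.
Qed.

Lemma side_length_le_h_plus V k : side_length V k <= h_plus V.
Proof. by rewrite /h_plus (bigmaxD1 k)// le_max lexx. Qed.

Lemma h_minus_le_side_length V k : h_minus V <= side_length V k.
Proof. by rewrite /h_minus (bigminD1 k)// ge_min lexx. Qed.

Lemma h_minus_le1 V : h_minus V <= 1.
Proof. exact: bigmin_le_id. Qed.

Lemma h_minus_ge0 V : subcube V -> 0 <= h_minus V.
Proof.
move=> cV; apply/bigmin_geP; split => // k _.
by have /andP[/ltW] := side_length_bounds k cV.
Qed.

Lemma h_plus_ge0 V : 0 <= h_plus V.
Proof. exact: bigmax_ge_id. Qed.

Lemma dist2_in_cell V x y : subcube V -> in_cell V x -> in_cell V y ->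
  dist2 x y <= Num.sqrt d%:R * h_plus V.
Proof.
move=> cV /forallP xV /forallP yV.
rewrite -[h_plus V]ger0_norm ?h_plus_ge0// -sqrtr_sqr -sqrtrM// ler_sqrt; last first.
  by rewrite mulr_ge0// sqr_ge0.
have -> : d%:R * h_plus V ^+ 2 = \sum_(k < d) h_plus V ^+ 2.
  by rewrite sumr_const card_ord mulr_natl.
apply: ler_sum => k _.
rewrite -[leLHS]real_normK ?num_real// lerXn2r ?nnegrE ?h_plus_ge0//.
apply: le_trans (side_length_le_h_plus V k); rewrite /side_length.
have [_ _ _ h _] := subcube_itv k cV.
have /andP[? ?] := h _ (xV k); have /andP[? ?] := h _ (yV k).
by rewrite ler_norml; apply/andP; split; lra.
Qed.

End cells.

Lemma lipschitz_const_ge0 (R : realType) (d : nat) (g : d.-tuple R -> R) (V : cell R d) :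
  0 <= lipschitz_const g V.
Proof.
rewrite /lipschitz_const; set K := [set c | _].
(* The infimum of the empty set is 0 by convention. *)
have [->|/set0P K0] := eqVneq K set0; first by rewrite inf0.
by apply: lb_le_inf => // c [].
Qed.

Lemma lipschitz_constP (R : realType) (d : nat) (g : d.-tuple R -> R)
    (V : cell R d) (L : R) : subcube V -> lipschitz_dist2 (@unit_cube R d) g L ->
  forall x y, in_cell V x -> in_cell V y ->
    `|g x - g y| <= lipschitz_const g V * dist2 x y.
Proof.
move=> cV gL x y xV yV.
have Vcube z : in_cell V z -> unit_cube z.
  move=> /forallP zV k; have [l0 _ h1 /(_ _ (zV k))/andP[? ?] _] := subcube_itv k cV.
  by apply/andP; split; lra.
have dist0 z t : 0 <= dist2 z t :> R by exact: sqrtr_ge0.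
pose K := [set c | 0 <= c /\ lipschitz_dist2 [set x | in_cell V x] g c].
have K0 : K !=set0.
  (* No sign is assumed for [L], whereas admissible constants are nonnegative. *)
  exists (Num.max 0 L); split; first by rewrite le_max lexx.
  move=> z t /Vcube zV /Vcube tV; apply: (le_trans (gL _ _ zV tV)).
  by rewrite ler_wpM2r// le_max lexx orbT.
(* The infimum is handled by dividing by the distance; at distance 0 any admissible constant yields
   the claim. *)
have [d0|d0] := eqVneq (dist2 x y) 0.
  have [c [_ cK]] := K0; have := cK x y xV yV; by rewrite d0 !mulr0.
have {}d0 : 0 < dist2 x y by rewrite lt_neqAle eq_sym d0 dist0.
rewrite -ler_pdivrMr//; apply: lb_le_inf => // c [_ cK].
by rewrite ler_pdivrMr//; exact: cK.
Qed.

(** * The splitting procedure *)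

Section sr_tree.
Context (R : realType) (d n : nat) (z : sample R d n) (m : nat) (beta : R)
  (cost : sr_split R d -> cell R d -> R).
Implicit Types (V : cell R d) (Pi : seq (cell R d)) (x : d.-tuple R).

(** The invariant of the construction: the last two clauses are re-established for each child by the
    admissibility of the split. *)
Definition regular_cell V :=
  [/\ subcube V, h_plus V <= beta * h_minus V & (m <= count_in z V)%N].

Lemma sr_step_regular Pi Pi' : sr_step z m beta cost Pi Pi' ->
  (forall V, V \in Pi -> regular_cell V) -> forall V, V \in Pi' -> regular_cell V.
Proof.
elim=> {Pi Pi'}[//|V s Pi Pi' _ [[[_ hl hr] [sS ml mr]] _] _ IH|V Pi Pi' _ _ IH] reg W.
  have [cV _ _] : regular_cell V by apply: reg; rewrite mem_head.
  rewrite !inE => /or3P[/eqP->|/eqP->|WPi].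
  - by split => //; exact: subcube_left_child.
  - by split => //; exact: subcube_right_child.
  - by apply: IH WPi => V' V'Pi; apply: reg; rewrite inE V'Pi orbT.
rewrite inE => /orP[/eqP->|WPi]; first by apply: reg; rewrite mem_head.
by apply: IH WPi => V' V'Pi; apply: reg; rewrite inE V'Pi orbT.
Qed.

Lemma sr_step_cover Pi Pi' x : sr_step z m beta cost Pi Pi' ->
  has (fun V => in_cell V x) Pi -> has (fun V => in_cell V x) Pi'.
Proof.
elim=> {Pi Pi'}[//|V s Pi Pi' _ _ _ IH|V Pi Pi' _ _ IH] /=.
  case/orP => [xV|/IH ->]; last by rewrite !orbT.
  have [xs|xs] := ltP (tnth x s.1) (cut_point V s).
    by rewrite in_left_child.
  by rewrite (in_right_child xV xs) orbT.
by case/orP => [->//|/IH ->]; rewrite orbT.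
Qed.

Lemma sr_step_size Pi Pi' : sr_step z m beta cost Pi Pi' -> (size Pi <= size Pi')%N.
Proof. by elim=> // *; rewrite /= ?ltnS ltnW. Qed.

(** A split lengthens the list and no step shortens it, so a step between lists of equal size keeps
    every cell. Comparing sizes, instead of asking for equal lists, gives the induction a hypothesis
    about the tails. *)
Lemma sr_step_fixed Pi Pi' : sr_step z m beta cost Pi Pi' -> size Pi = size Pi' ->
  forall V, V \in Pi -> populated_splits z m V = set0.
Proof.
elim=> {Pi Pi'}[//|V s Pi Pi' _ _ /sr_step_size ss IH /= [e]|V Pi Pi' VS _ IH /= [e] W].
  by rewrite e ltnn in ss.
by rewrite inE => /orP[/eqP->//|]; exact: IH.
Qed.

Hypotheses (beta1 : 1 <= beta) (d0 : (0 < d)%N) (mn : (m <= n)%N)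
  (z_cube : forall i, unit_cube (tnth z i).1).

Lemma regular_root : regular_cell (root_cell R d).
Proof.
split.
- exact: subcube_root.
- have side1 k : side_length (root_cell R d) k = 1.
    by rewrite /side_length ffunE/= subr0.
  have -> : h_plus (root_cell R d) = 1.
    apply/eqP; rewrite eq_le -{2}(side1 (Ordinal d0)) side_length_le_h_plus andbT.
    by apply/bigmax_leP; split => // k _; rewrite side1.
  apply: le_trans (_ : beta * 1 <= _); first by rewrite mulr1.
  rewrite ler_wpM2l// ?(le_trans ler01)//.
  by apply/bigmin_geP; split => // k _; rewrite side1.
- suff -> : count_in z (root_cell R d) = n by [].
  rewrite /count_in -[RHS]card_ord; apply: eq_card => i; rewrite !inE.
  by apply/in_root_cell; exact: z_cube.
Qed.

Lemma sr_final_cell Pi x : sr_final z m beta cost Pi -> unit_cube x ->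
  let V := local_map Pi x in
  [/\ regular_cell V, in_cell V x & populated_splits z m V = set0].
Proof.
move=> [reach fin] xc /=.
have [reg cov] : (forall V, V \in Pi -> regular_cell V) /\ has (fun V => in_cell V x) Pi.
  elim: reach => {Pi fin}[|Pi Pi' _ [reg cov] st].
    split => [V|]; first by rewrite inE => /eqP ->; exact: regular_root.
    by rewrite /= orbF; apply/in_root_cell.
  by split; [exact: sr_step_regular reg|exact: sr_step_cover cov].
(* Since some cell covers [x], [find] succeeds and [nth] does not fall back on its default. *)
have VPi : local_map Pi x \in Pi by rewrite mem_nth// -has_find.
split; [exact: reg| |exact: (sr_step_fixed fin)].
exact: (nth_find (root_cell R d) cov).
Qed.

(** With [2 * m] points whose first coordinates differ, a cut in that direction just above the [m]
    lowest points is populated. Only counts enter [populated_splits], so the shape of the children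
    is irrelevant here. *)
Lemma unpopulated_count V : (0 < m)%N -> subcube V ->
  {in [pred i | in_cell V (tnth z i).1] &,
    injective (fun i => tnth (tnth z i).1 (Ordinal d0))} ->
  populated_splits z m V = set0 -> (count_in z V < 2 * m)%N.
Proof.
move=> m0 cV inj noS; rewrite ltnNge; apply/negP => mV.
pose A := [set i : 'I_n | in_cell V (tnth z i).1]%SET.
pose f i := tnth (tnth z i).1 (Ordinal d0).
have fA : {in A &, injective f} by move=> i j; rewrite !inE => iV jV; exact: inj.
have [|B [BA Bm Bf]] := ex_lower_subset (m := m) fA.
  by apply: leq_trans mV; rewrite leq_pmull.
have mAB : (m <= #|(A :\: B)%SET|)%N.
  rewrite cardsD (finset.setIidPr BA) Bm leq_subRL; last first.
    by rewrite -Bm subset_leq_card.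
  by apply: leq_trans mV; rewrite mul2n -addnn.
have /card_gt0P[i0 i0B] : (0 < #|B|)%N by rewrite Bm.
have /card_gt0P[j0 j0B] : (0 < #|(A :\: B)%SET|)%N by exact: leq_trans mAB.
case: (arg_maxP f i0B) => a aB amax.
case: (arg_minP f j0B) => b bB bmin.
have {}aB : a \in B := aB; have {}bB : b \in (A :\: B)%SET := bB.
have fab : f a < f b by exact: Bf.
have [_ lh _ Vle Vlt] := subcube_itv (Ordinal d0) cV.
pose lo := itv_lo (V (Ordinal d0)); pose hi := itv_hi (V (Ordinal d0)).
have inV i : i \in A -> lo <= f i <= hi.
  by rewrite inE => /forallP iV; exact: (Vle _ (iV (Ordinal d0))).
have /andP[loa _] := inV a (fintype.subsetP BA _ aB).
have /andP[_ bhi] : lo <= f b <= hi by apply: inV; case/setDP: bB.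
(* The cut passes halfway between the highest point [a] of the lower group and the lowest point [b]
   of the rest; [s] expresses it as a proportion of the side. *)
pose t := (f a + f b) / 2.
have w0 : 0 < hi - lo by rewrite subr_gt0.
pose s : sr_split R d := (Ordinal d0, (t - lo) / (hi - lo)).
have cutE : cut_point V s = t.
  by rewrite /cut_point /= /side_length -/lo -/hi divfK ?gt_eqF//; lra.
suff : populated_splits z m V s by rewrite noS.
split.
- apply/andP; rewrite /=; split; first by rewrite divr_gt0// /t; lra.
  by rewrite ltr_pdivrMr// /t; lra.
- rewrite -Bm; apply: subset_leq_card; apply/fintype.subsetP => i iB; rewrite inE.
  apply: in_left_child; first by have := fintype.subsetP BA _ iB; rewrite inE.
  have fia : f i <= f a := amax _ iB.
  by rewrite cutE -/(f i) /t; lra.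
- apply: leq_trans mAB _; apply: subset_leq_card; apply/fintype.subsetP => i iB; rewrite inE.
  apply: in_right_child; first by have /finset.setDP[] := iB; rewrite inE.
  have fbi : f b <= f i := bmin _ iB.
  by rewrite cutE -/(f i) /t; lra.
Qed.

End sr_tree.

(** * Grids *)

Section grid.
Context (R : realType) (K : nat).

(* The cap is idle on [0, 1]. *)
Definition level (t : R) : 'I_K.+1 := inord (minn K (Num.truncn (K%:R * t))).

Lemma levelE t : level t = minn K (Num.truncn (K%:R * t)) :> nat.
Proof. by rewrite inordK// ltnS geq_minl. Qed.

Lemma le_level s t : s <= t -> (level s <= level t)%N.
Proof.
move=> st; rewrite !levelE leq_min geq_minl/= (leq_trans (geq_minr _ _))//.
by apply: le_truncn; rewrite ler_wpM2l.
Qed.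

(** A fibre is a difference of two sets [i < level t], each a half-line below the cap [K] and empty
    from there on. *)
Lemma measurable_level j : measurable (level @^-1` [set j]).
Proof.
have mge i : measurable [set t : R | (i < Num.truncn (K%:R * t))%N].
  have -> : [set t : R | (i < Num.truncn (K%:R * t))%N] =
      (fun t => K%:R * t) @^-1` `[i.+1%:R, +oo[.
    by apply/seteqP; split => t; rewrite /= in_itv/= andbT truncn_gt_nat.
  have mK : measurable_fun setT (fun t : R => K%:R * t) by exact: measurable_funM.
  by rewrite -[X in measurable X]setTI; exact: mK.
have mgt i : measurable [set t | (i < level t)%N].
  have [iK|Ki] := ltnP i K.
    have -> : [set t | (i < level t)%N] = [set t : R | (i < Num.truncn (K%:R * t))%N].
      by apply/seteqP; split => t; rewrite /= levelE leq_min iK.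
    exact: mge.
  have -> : [set t | (i < level t)%N] = set0; last exact: measurable0.
  by apply/seteqP; split => t //=; rewrite levelE leq_min ltnNge Ki.
have -> : level @^-1` [set j] =
    (if nat_of_ord j is i.+1 then [set t | (i < level t)%N] else setT) `\`
    [set t | (j < level t)%N].
  apply/seteqP; split => t /=.
    move=> e; split; last by rewrite e ltnn.
    by move: (congr1 (@nat_of_ord _) e); case: (nat_of_ord j) => //= i ->.
  move=> [jt /negP]; rewrite -leqNgt => tj; apply/val_inj/eqP; rewrite eqn_leq tj/=.
  by case: (nat_of_ord j) jt.
by apply: measurableD => //; case: (nat_of_ord j).
Qed.

Lemma level_itv t : (0 < K)%N -> 0 <= t <= 1 ->
  (level t)%:R / K%:R <= t <= (level t).+1%:R / K%:R.
Proof.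
move=> K0 /andP[t0 t1]; have K0' : 0 < K%:R :> R by rewrite ltr0n.
have tK : level t = Num.truncn (K%:R * t) :> nat.
  rewrite levelE; apply/minn_idPr; rewrite -(ler_nat R).
  apply: (@le_trans _ _ (K%:R * t)); last by rewrite -[leRHS]mulr1 ler_wpM2l.
  by rewrite truncn_le mulr_ge0.
have /andP[h1 h2] : (Num.truncn (K%:R * t))%:R <= K%:R * t < (Num.truncn (K%:R * t)).+1%:R.
  by apply: truncn_itv; rewrite mulr_ge0.
by rewrite ler_pdivrMr// ler_pdivlMr// tK ![t * _]mulrC h1 ltW.
Qed.

End grid.

(** The two bounds are the number of points that violate the left end and the number that satisfy
    the right end. Ranks count strictly smaller points, so ties are allowed. *)
Lemma interval_ranks (R : realType) (n : nat) (x : 'I_n -> R) (I : interval R) :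
  exists ab : 'I_n.+1 * 'I_n.+1, forall i,
    (x i \in I) = (ab.1 <= #|[set j | (x j < x i)%R]%SET| < ab.2)%N.
Proof.
case: I => l r.
have card_lt (A : {set 'I_n}) : (#|A| < n.+1)%N by rewrite ltnS -[leqRHS]card_ord max_card.
exists (Ordinal (card_lt [set j | ~~ (l <= BLeft (x j))%O]%SET),
        Ordinal (card_lt [set j | (BRight (x j) <= r)%O]%SET)) => i /=.
rewrite itv_boundlr; congr andb.
  apply/idP/idP => [li|].
    apply: subset_leq_card; apply/fintype.subsetP => j; rewrite !inE -ltNge => jl.
    by have := lt_le_trans jl li; rewrite bnd_simp.
  apply: contraTT; rewrite -ltNge -ltnNge => li; apply: proper_card; apply/properP; split.
    apply/fintype.subsetP => j; rewrite !inE -ltNge => ji.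
    by apply: lt_trans li; rewrite bnd_simp.
  by exists i; rewrite inE -?ltNge// ltxx.
apply/idP/idP => [ri|].
  apply: proper_card; apply/properP; split.
    apply/fintype.subsetP => j; rewrite !inE => ji.
    by apply: le_trans ri; rewrite bnd_simp ltW.
  by exists i; rewrite inE// ltxx.
apply: contraTT; rewrite -ltNge -leqNgt => ri.
apply: subset_leq_card; apply/fintype.subsetP => j; rewrite !inE => jr.
by have := le_lt_trans jr ri; rewrite bnd_simp.
Qed.

Lemma bernoulli_inequality (R : realType) (x : R) (d : nat) : 0 <= x <= 1 ->
  1 - d%:R * x <= (1 - x) ^+ d.
Proof.
move=> /andP[x0 x1]; elim: d => [|d IHd]; first by rewrite mul0r subr0 expr0.
rewrite exprS; apply: (@le_trans _ _ ((1 - x) * (1 - d%:R * x))).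
  rewrite -[d.+1]addn1 natrD.
  have -> : (1 - x) * (1 - d%:R * x) = 1 - (d%:R + 1) * x + d%:R * x ^+ 2 by ring.
  by rewrite lerDl mulr_ge0// sqr_ge0.
by rewrite ler_wpM2l// subr_ge0.
Qed.

(** The two indices of a coordinate are not ordered, so a box may be empty; there are $(K+1)^{2d}$
    index families. *)
Definition grid_box (R : realType) (d K : nat)
    (q : {ffun 'I_d -> 'I_K.+1 * 'I_K.+1}) : set (d.-tuple R) :=
  box (fun k => (q k).1%:R / K%:R) (fun k => (q k).2%:R / K%:R).

(** Rounding inwards loses at most $1/K$ at each end. Landing strictly inside the side gives
    membership in [V] for open and closed ends alike. *)
Lemma inner_grid_box (R : realType) (d K : nat) (V : cell R d) :
  (0 < K)%N -> subcube V ->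
  exists q : {ffun 'I_d -> 'I_K.+1 * 'I_K.+1},
    (forall x, grid_box q x -> in_cell V x) /\
    forall k, side_length V k - 2 / K%:R <= (q k).2%:R / K%:R - (q k).1%:R / K%:R.
Proof.
move=> K0 cV; have K0' : 0 < K%:R :> R by rewrite ltr0n.
have /choice[q qP] : forall k, exists ab : 'I_K.+1 * 'I_K.+1,
    [/\ itv_lo (V k) < ab.1%:R / K%:R, ab.2%:R / K%:R < itv_hi (V k) &
    side_length V k - 2 / K%:R <= ab.2%:R / K%:R - ab.1%:R / K%:R].
  move=> k; have [l0 lh h1 _ _] := subcube_itv k cV.
  set lo := itv_lo (V k) in l0 lh *; set hi := itv_hi (V k) in h1 lh *.
  have lt_trunc (t : R) : 0 <= t < 1 -> (Num.truncn (K%:R * t) < K)%N.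
    move=> /andP[t0 t1]; rewrite truncn_lt_nat ?mulr_ge0//.
    by rewrite -[ltRHS]mulr1 ltr_pM2l.
  have aK : (Num.truncn (K%:R * lo) < K)%N by apply: lt_trunc; apply/andP; split; lra.
  have bK : (Num.truncn (K%:R * (1 - hi)) < K)%N by apply: lt_trunc; apply/andP; split; lra.
  have /andP[ha1 ha2] := truncn_itv (mulr_ge0 (ltW K0') l0).
  have hi1 : 0 <= 1 - hi by rewrite subr_ge0.
  have /andP[hb1 hb2] := truncn_itv (mulr_ge0 (ltW K0') hi1).
  (* The lower index is the first multiple of $1/K$ strictly above [lo]; the upper one is its mirror
     image under $t\mapsto 1-t$. *)
  exists (inord (Num.truncn (K%:R * lo)).+1, inord (K - (Num.truncn (K%:R * (1 - hi))).+1)).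
  rewrite /= !inordK ?ltnS// ?leq_subr//.
  rewrite -/lo -/hi natrB// ltr_pdivlMr// ltr_pdivrMr// -mulrBl lerBlDr.
  rewrite -mulrDl ler_pdivlMr// /side_length -/lo -/hi.
  by rewrite -!natr1 in ha2 hb2 *; split; lra.
exists [ffun k => q k]; split => [x xq|k]; last by rewrite ffunE; case: (qP k).
apply/forallP => k; have [_ _ _ _] := subcube_itv k cV; apply.
have := xq k; rewrite ffunE; have [? ? _] := qP k => /andP[? ?].
by apply/andP; split; lra.
Qed.

(** Here [p q] stands for the probability of [grid_box q]. Leaving it abstract makes the argument
    deterministic: the hypotheses are the lower bound from the density and the property of a typical
    sample. *)
Lemma h_minus_exp_le (R : realType) (d n m : nat) (z : sample R d n) (b : R)
    (p : {ffun 'I_d -> 'I_(2 * n).+1 * 'I_(2 * n).+1} -> R) (V : cell R d) :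
  (0 < d <= m)%N -> (0 < n)%N -> 0 < b <= 1 -> subcube V ->
  (forall q : {ffun 'I_d -> 'I_(2 * n).+1 * 'I_(2 * n).+1},
     (forall k, ((q k).1 <= (q k).2)%N) ->
     b * \prod_k ((q k).2%:R / (2 * n)%:R - (q k).1%:R / (2 * n)%:R) <= p q) ->
  (forall q, 4 * m%:R <= n%:R * p q ->
     (2 * m <= #|[set i | `[< grid_box q (tnth z i).1 >]]%SET|)%N) ->
  (count_in z V < 2 * m)%N ->
  h_minus V ^+ d <= 5 * m%:R / (n%:R * b).
Proof.
move=> /andP[d0 dm] n0 /andP[b0 b1] cV pge pcount Vm; rewrite leNgt; apply/negP => hV.
set h := h_minus V in hV; have h1 : h <= 1 by exact: h_minus_le1.
have h0 : 0 <= h by exact: h_minus_ge0.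
have n0' : 0 < n%:R :> R by rewrite ltr0n.
have m0' : 0 < m%:R :> R by rewrite ltr0n (leq_trans d0).
have dm' : d%:R <= m%:R :> R by rewrite ler_nat.
(* Since [b] and [h] are at most 1, [h] is at least [5 m / n]; the grid box thus
   keeps a proportion [1 - 1 / (5 m)] of each side, hence 4/5 of the volume as
   [d <= m]. *)
have hmn : m%:R * 5 / n%:R <= h.
  apply: (@le_trans _ _ (h ^+ d)); last exact: ler_iXnr.
  apply: le_trans (ltW hV); rewrite [m%:R * 5]mulrC ler_wpM2l ?mulr_ge0//.
  by rewrite lef_pV2 ?posrE ?mulr_gt0// ger_pMr.
have K0 : (0 < 2 * n)%N by rewrite muln_gt0.
have [q [qV qside]] := inner_grid_box K0 cV.
(* With mesh $1/(2n)$ the two ends together lose $1/n$, which [hmn] bounds by $h/(5m)$. *)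
have KE : 2 / (2 * n)%:R = n%:R^-1 :> R by rewrite natrM invfM mulrA divff ?mul1r.
pose x : R := (5 * m%:R)^-1.
have x0 : 0 <= x by rewrite invr_ge0 mulr_ge0.
have x1 : x <= 1.
  rewrite invf_le1 ?mulr_gt0//; have : (1 : R) <= m%:R by rewrite ler1n (leq_trans d0).
  lra.
have side k : h * (1 - x) <= (q k).2%:R / (2 * n)%:R - (q k).1%:R / (2 * n)%:R.
  apply: le_trans (qside k); rewrite KE mulrBr mulr1 lerB//.
    exact: h_minus_le_side_length.
  rewrite /x ler_pdivlMr ?mulr_gt0// ler_pdivrMl//.
  by move: hmn; rewrite ler_pdivrMr//; lra.
have hx0 : 0 <= h * (1 - x) by rewrite mulr_ge0// subr_ge0.
have qle k : ((q k).1 <= (q k).2)%N.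
  have := le_trans hx0 (side k); rewrite subr_ge0 ler_pM2r ?invr_gt0 ?ltr0n//.
  by rewrite ler_nat.
have prod_ge : (h * (1 - x)) ^+ d <=
    \prod_k ((q k).2%:R / (2 * n)%:R - (q k).1%:R / (2 * n)%:R).
  rewrite -[X in _ ^+ X]card_ord -prodr_const; apply: ler_prod => k _.
  by rewrite hx0 side.
have bern : 4 / 5 <= (1 - x) ^+ d.
  apply: le_trans (bernoulli_inequality d _); last by rewrite x0.
  have : d%:R * x <= 5^-1 by rewrite ler_pdivrMr ?mulr_gt0//; lra.
  lra.
have : (2 * m <= #|[set i | `[< grid_box q (tnth z i).1 >]]%SET|)%N.
  apply: pcount; apply: (@le_trans _ _ (n%:R * (b * (h * (1 - x)) ^+ d))).
    rewrite exprMn (_ : _ * (b * _) = h ^+ d * (n%:R * b) * (1 - x) ^+ d); last by ring.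
    rewrite (_ : 4 * m%:R = 5 * m%:R * (4 / 5)); last by field.
    apply: ler_pM => //.
    by move: hV; rewrite ltr_pdivrMr ?mulr_gt0// => /ltW.
  rewrite ler_wpM2l//; apply: le_trans (pge q qle).
  by rewrite ler_wpM2l// ltW.
rewrite leqNgt => /negP; apply; apply: leq_ltn_trans Vm.
apply: subset_leq_card; apply/fintype.subsetP => i; rewrite !inE.
by move=> gi; exact: (qV _ gi).
Qed.

(** * The error of the tree for a typical sample *)

Definition code (R : realType) (d K : nat) (x : d.-tuple R) : {ffun 'I_d -> 'I_K.+1} :=
  [ffun k => level K (tnth x k)].

(** A selection rule of the noise bound. Ranks are taken among levels instead of coordinates, so
    that the selected set is a function of the codes. *)
Definition rank_box (d n K : nat) (ab : {ffun 'I_d -> 'I_n.+1 * 'I_n.+1})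
    (c : {ffun 'I_n -> {ffun 'I_d -> 'I_K.+1}}) : {set 'I_n} :=
  [set i | [forall k, ((ab k).1 <= #|[set j | (c j k < c i k)%N]%SET| < (ab k).2)%N]]%SET.

(** [level] is monotone, and strictly so on points in different slabs; ranks among levels then agree
    with ranks among coordinates, to which [interval_ranks] applies. *)
Lemma cell_rank_box (R : realType) (d n K : nat) (z : sample R d n) (V : cell R d) :
  (forall i j k, i != j -> level K (tnth (tnth z i).1 k) != level K (tnth (tnth z j).1 k)) ->
  exists ab, [set i | in_cell V (tnth z i).1]%SET =
    rank_box ab [ffun i => code K (tnth z i).1].
Proof.
move=> sep; have /choice[ab abP] := fun k => interval_ranks (fun i => tnth (tnth z i).1 k) (V k).
exists [ffun k => ab k]; apply/setP => i; rewrite !inE; apply: eq_forallb => k.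
rewrite abP !ffunE; congr (_ <= _ < _)%N; apply: eq_card => j; rewrite !inE !ffunE.
all: apply/idP/idP => [ji|]; last first.
1,3: by apply: contraTT; rewrite -leNgt -leqNgt; exact: le_level.
all: rewrite ltn_neqAle (le_level K (ltW ji)) andbT; apply: sep.
all: by apply: contraTneq ji => ->; rewrite ltxx.
Qed.

(** The error splits into the average noise and the average of [g] at the sample points of [V] minus
    [g x]. *)
Lemma local_average_error (R : realType) (d n : nat) (z : sample R d n)
    (g : d.-tuple R -> R) (V : cell R d) (x : d.-tuple R) (t B : R) :
  (0 < count_in z V)%N ->
  `|\sum_(i < n | in_cell V (tnth z i).1) ((tnth z i).2 - g (tnth z i).1)| <= t ->
  (forall y, in_cell V y -> `|g y - g x| <= B) ->
  `|local_average z V - g x| <= t / (count_in z V)%:R + B.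
Proof.
move=> N0 tP BP; have N0' : 0 < (count_in z V)%:R :> R by rewrite ltr0n.
have sumN (c : R) : \sum_(i < n | in_cell V (tnth z i).1) c = (count_in z V)%:R * c.
  by rewrite sumr_const mulr_natl /count_in cardsE.
have -> : local_average z V - g x =
    (\sum_(i < n | in_cell V (tnth z i).1) ((tnth z i).2 - g (tnth z i).1) +
     \sum_(i < n | in_cell V (tnth z i).1) (g (tnth z i).1 - g x)) / (count_in z V)%:R.
  rewrite /local_average -big_split/=.
  rewrite -[g x in LHS](mulKf (lt0r_neq0 N0')) -sumN [X in _ - X]mulrC -mulrBl -sumrB.
  by congr (_ / _); apply: eq_bigr => i _; ring.
rewrite normrM normfV [`|_%:R|]ger0_norm ?ler0n// ler_pdivrMr// mulrDl divfK ?gt_eqF//.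
apply: (le_trans (ler_normD _ _)); apply: lerD => //.
apply: (le_trans (ler_norm_sum _ _ _)); rewrite mulrC -sumN.
by apply: ler_sum => i; exact: BP.
Qed.

(** The deterministic half of the theorem: the hypotheses on [z] describe a typical sample, and no
    probability appears. *)
Lemma sr_tree_error (R : realType) (d n m K : nat) (z : sample R d n) (beta b L l v : R)
    (cost : sr_split R d -> cell R d -> R) (Pi : seq (cell R d))
    (g : d.-tuple R -> R)
    (p : {ffun 'I_d -> 'I_(2 * n).+1 * 'I_(2 * n).+1} -> R) :
  (0 < d <= m)%N -> (m <= n)%N -> 1 <= beta -> 0 < b <= 1 -> 0 <= l -> 0 <= v ->
  lipschitz_dist2 (@unit_cube R d) g L ->
  (forall i, unit_cube (tnth z i).1) ->
  (forall i j k, i != j -> level K (tnth (tnth z i).1 k) != level K (tnth (tnth z j).1 k)) ->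
  (forall ab, let A := rank_box ab [ffun i => code K (tnth z i).1] in
     `|\sum_(i in A) ((tnth z i).2 - g (tnth z i).1)| <=
       Num.sqrt (2 * v * #|A|%:R * l)) ->
  (forall q : {ffun 'I_d -> 'I_(2 * n).+1 * 'I_(2 * n).+1},
     (forall k, ((q k).1 <= (q k).2)%N) ->
     b * \prod_k ((q k).2%:R / (2 * n)%:R - (q k).1%:R / (2 * n)%:R) <= p q) ->
  (forall q, 4 * m%:R <= n%:R * p q ->
     (2 * m <= #|[set i | `[< grid_box q (tnth z i).1 >]]%SET|)%N) ->
  sr_final z m beta cost Pi ->
  forall x, unit_cube x -> let V := local_map Pi x in
  `|local_average z V - g x| <= Num.sqrt (2 * v / m%:R * l)
    + lipschitz_const g V * beta * Num.sqrt d%:R * (5 * m%:R / (n%:R * b)) `^ (d%:R^-1).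
Proof.
move=> /andP[d0 dm] mn beta1 b01 l0 v0 gL zc sep noise pge pcount fin x xc /=.
set V := local_map Pi x.
have m0 : (0 < m)%N by exact: leq_trans dm.
have n0 : (0 < n)%N by exact: leq_trans mn.
have [[cV hV mV] xV noS] := sr_final_cell beta1 d0 mn zc fin xc.
have N0 : (0 < count_in z V)%N by exact: leq_trans mV.
have Vm : (count_in z V < 2 * m)%N.
  apply: (unpopulated_count (d0 := d0)) => // i j _ _ /= ij.
  by apply/eqP; apply: contraT => /(sep _ _ (Ordinal d0)); rewrite ij eqxx.
have hd : h_minus V ^+ d <= 5 * m%:R / (n%:R * b).
  by apply: (h_minus_exp_le _ n0 b01 cV pge pcount Vm); rewrite d0.
have h0 := h_minus_ge0 cV.
have hle : h_minus V <= (5 * m%:R / (n%:R * b)) `^ (d%:R^-1).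
  have -> : h_minus V = (h_minus V ^+ d) `^ (d%:R^-1).
    rewrite -powR_mulrn// -powRrM divff ?pnatr_eq0 -?lt0n//.
    by rewrite powRr1.
  by apply: ge0_ler_powR; rewrite ?nnegrE ?invr_ge0 ?exprn_ge0// (le_trans _ hd)// exprn_ge0.
pose t := Num.sqrt (2 * v * (count_in z V)%:R * l).
have tP : `|\sum_(i < n | in_cell V (tnth z i).1) ((tnth z i).2 - g (tnth z i).1)| <= t.
  have [ab abE] := cell_rank_box V sep.
  have := noise ab; rewrite -abE /=.
  by under eq_bigl do rewrite inE.
have BP y : in_cell V y -> `|g y - g x| <= lipschitz_const g V * (Num.sqrt d%:R * h_plus V).
  move=> yV; apply: (le_trans (lipschitz_constP cV gL yV xV)).
  by rewrite ler_wpM2l ?lipschitz_const_ge0//; exact: dist2_in_cell.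
apply: (le_trans (local_average_error N0 tP BP)); apply: lerD.
  have N0' : 0 < (count_in z V)%:R :> R by rewrite ltr0n.
  (* With $N$ points in the cell, the average noise is at most $\sqrt{2vl/N}$, and $N\ge m$. *)
  rewrite ler_pdivrMr// -[X in _ * X]ger0_norm ?ler0n// -sqrtr_sqr -sqrtrM; last first.
    by rewrite mulr_ge0// divr_ge0// mulr_ge0.
  rewrite ler_wsqrtr//.
  rewrite [leRHS](_ : _ = 2 * v * (count_in z V)%:R * l * ((count_in z V)%:R / m%:R)); last first.
    by field; rewrite pnatr_eq0 -lt0n.
  rewrite -[leLHS]mulr1 ler_wpM2l ?mulr_ge0//.
  by rewrite ler_pdivlMr ?ltr0n// mul1r ler_nat.
rewrite -!mulrA ler_wpM2l ?lipschitz_const_ge0// mulrCA ler_wpM2l ?sqrtr_ge0//.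
apply: (le_trans hV); rewrite [5 * (_ / _)]mulrA.
by apply: ler_wpM2l => //; exact: le_trans beta1.
Qed.

(** * Atypical samples are rare *)

Lemma measurable_code_fiber (R : realType) (d K : nat) (c : {ffun 'I_d -> 'I_K.+1}) :
  measurable (@code R d K @^-1` [set c]).
Proof.
have -> : @code R d K @^-1` [set c] =
    \bigcap_(k in [set: 'I_d]) [set x | (@level R K @^-1` [set c k]) (tnth x k)].
  apply/seteqP; split => x /= h.
    by move=> k _ /=; rewrite -h ffunE.
  by apply/ffunP => k; rewrite ffunE; exact: h.
apply: fin_bigcap_measurable => // k _.
exact: (measurable_coordinate_preimage _ (measurable_level _)).
Qed.

Section sample_events.
Context (R : realType) (dT : measure_display) (T : measurableType dT)
  (P : probability T R) (n d : nat).
Variables (Z : {RV P >-> (d.-tuple R * R)%type})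
  (Zs : 'I_n -> {RV P >-> (d.-tuple R * R)%type})
  (f : d.-tuple R -> R) (b M : R).
Hypotheses (iZ : mutually_independent Zs)
  (idZ : forall i (A : set (d.-tuple R * R)), measurable A ->
    distribution P (Zs i) A = distribution P Z A)
  (b0 : 0 < b) (M0 : 0 < M)
  (Zf : has_density_on_cube P (fun w => (Z w).1) f)
  (fbM : forall x, @unit_cube R d x -> b <= f x <= M).

Let measurable_fst_preimage (A : set (d.-tuple R)) : measurable A ->
  measurable [set x : d.-tuple R * R | A x.1].
Proof. by move=> mA; rewrite -[X in measurable X]setTI; exact: measurable_fst. Qed.

Let same_law i (A : set (d.-tuple R)) : measurable A ->
  P ((fun w => (Zs i w).1) @^-1` A) = P ((fun w => (Z w).1) @^-1` A).
Proof. by move=> mA; have := idZ i (measurable_fst_preimage mA). Qed.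

Let mfst (W : {RV P >-> (d.-tuple R * R)%type}) (A : set (d.-tuple R)) :
  measurable A -> measurable ((fun w => (W w).1) @^-1` A).
Proof. by move=> mA; exact: (measurable_preimage_RV W (measurable_fst_preimage mA)). Qed.

Lemma outside_cube_null i :
  measurable [set w | ~ unit_cube (Zs i w).1] /\
  P [set w | ~ unit_cube (Zs i w).1] = 0%E.
Proof.
have mc : measurable ((fun w => (Zs i w).1) @^-1` @unit_cube R d).
  by apply: mfst; rewrite unit_cube_box; exact: measurable_box.
split; first exact: measurableC.
rewrite -[X in P X]/(~` ((fun w => (Zs i w).1) @^-1` @unit_cube R d)).
rewrite probability_setC// same_law; last by rewrite unit_cube_box; exact: measurable_box.
by rewrite (density_cube_eq1 Zf) subee.
Qed.

Lemma slab_le K i k c : (0 < K)%N ->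
  (P [set w | level K (tnth (Zs i w).1 k) = c] <= (M / K%:R)%:E)%E.
Proof.
move=> K0; have K0' : K%:R != 0 :> R by rewrite pnatr_eq0 -lt0n.
have mA := measurable_coordinate_preimage k (@measurable_level R K c).
have := same_law i mA; rewrite /preimage/= => ->.
have -> : M / K%:R = M * (c.+1%:R / K%:R - c%:R / K%:R) by rewrite -natr1; field.
have st : c%:R / K%:R <= c.+1%:R / K%:R :> R.
  by rewrite ler_pM2r ?invr_gt0 ?ltr0n// ler_nat.
apply: (density_slab_le b0 M0 Zf fbM k (@measurable_level R K c) st).
by move=> t [/= <- t01]; rewrite /= in_itv/=; apply: level_itv.
Qed.

(** By independence two points share a given slab with probability at most $(M/K)^2$. Summed over
    the [K.+1] slabs this is of order $1/K$, hence negligible on a fine grid. *)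
Lemma collision_le K i j k : (0 < K)%N -> i != j ->
  measurable [set w | level K (tnth (Zs i w).1 k) = level K (tnth (Zs j w).1 k)] /\
  (P [set w | level K (tnth (Zs i w).1 k) = level K (tnth (Zs j w).1 k)] <=
    (K.+1%:R * (M / K%:R) ^+ 2)%:E)%E.
Proof.
move=> K0 ij; pose S c i := [set w | level K (tnth (Zs i w).1 k) = c].
have mA c := measurable_coordinate_preimage k (@measurable_level R K c).
have mS c i' : measurable (S c i') by exact: (mfst (Zs i') (mA c)).
have PS c : (P (S c i `&` S c j) <= ((M / K%:R) ^+ 2)%:E)%E.
  have := iZ [set i; j]%SET (fun=> measurable_fst_preimage (mA c)).
  rewrite big_setU1 ?inE//= big_set1 => E.
  have -> : S c i `&` S c j = \bigcap_(i' in [set` [set i; j]%SET]) S c i'.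
    apply/seteqP; split => w; last by move=> h; split; apply: h; rewrite /= !inE eqxx ?orbT.
    by move=> [wi wj] i' /=; rewrite !inE => /orP[] /eqP ->.
  rewrite [X in (X <= _)%E]E lee_fin expr2.
  have fine_le i' : 0 <= fine (P (S c i')) <= M / K%:R.
    by rewrite fine_ge0//= -lee_fin fineK ?fin_num_measure//; exact: slab_le.
  by have /andP[? ?] := fine_le i; have /andP[? ?] := fine_le j; apply: ler_pM.
have [] := probability_finite_union (P := P) (fun c => measurableI _ _ (mS c i) (mS c j)) PS.
have -> : [set w | level K (tnth (Zs i w).1 k) = level K (tnth (Zs j w).1 k)] =
    \bigcup_c (S c i `&` S c j).
  apply/seteqP; split => [w /= e|w [c _ [/= -> ->]]//].
  by exists (level K (tnth (Zs i w).1 k)).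
by move=> mU; rewrite sumr_const card_ord mulr_natl.
Qed.

(** The condition on [p] is part of the event, so that one bound holds for all boxes: the event is
    empty for boxes of small probability. *)
Lemma sparse_box_le (m : nat) (q : {ffun 'I_d -> 'I_(2 * n).+1 * 'I_(2 * n).+1}) :
  let p := fine (P ((fun w => (Z w).1) @^-1` grid_box q)) in
  let B := [set w | 4 * m%:R <= n%:R * p /\
    (#|[set i | `[< grid_box q (Zs i w).1 >]]%SET| < 2 * m)%N] in
  (0 < m)%N -> measurable B /\ (P B <= (expR (- (m%:R / 4)))%:E)%E.
Proof.
move=> p B m0.
have mq : measurable (grid_box q : set (d.-tuple R)) by exact: measurable_box.
have [np|np] := boolP (4 * m%:R <= n%:R * p); last first.
  have -> : B = set0 by apply/seteqP; split => w // [np1]; rewrite np1 in np.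
  by rewrite measure0 lee_fin expR_ge0; split.
pose W := [set x : d.-tuple R * R | grid_box q x.1].
have -> : B = [set w | (#|[set i | `[< W (Zs i w) >]]%SET| <= (2 * m).-1)%N].
  have leE a : (a <= (2 * m).-1)%N = (a < 2 * m)%N by rewrite -ltnS prednK ?muln_gt0.
  by apply/seteqP; split => w /=; rewrite leE => // -[].
have pE i : P (Zs i @^-1` W) = p%:E.
  have := same_law i mq; rewrite /preimage/= => ->.
  by rewrite fineK// fin_num_measure//; exact: mfst.
have [mB PB] := binomial_lower_tail (2 * m).-1 iZ (measurable_fst_preimage mq) pE.
split => //; apply: (le_trans PB); rewrite lee_fin.
(* The bound $\ln 2\le 7/8$ is sharp enough: with $np\ge 4m$ the exponent is at most
   $(7/8)2m-2m=-m/4$. It follows from $(1+7/16)^2\ge 2$. *)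
have two : 2 <= expR (7 / 8) :> R.
  have -> : (7 / 8 : R) = 7 / 16 + 7 / 16 by field.
  rewrite expRD.
  have := expR_ge1Dx (7 / 16 : R); nra.
apply: (@le_trans _ _ (expR (7 / 8) ^+ (2 * m) * expR (- (n%:R * p / 2)))).
  rewrite ler_wpM2r ?expR_ge0//.
  apply: (@le_trans _ _ (2 ^+ (2 * m))); first by rewrite ler_eXn2l ?ltr1n// leq_pred.
  by apply: lerXn2r; rewrite ?nnegrE ?expR_ge0.
rewrite -expRM_natl -expRD ler_expR natrM; lra.
Qed.

End sample_events.

(** * Numerical constants and the final union bound *)

Lemma confidence_numerics (R : realType) (n d m : nat) (delta : R) :
  0 < delta < 1 -> (0 < d)%N -> (0 < n)%N ->
  4 * ln (4 * (2 * n%:R + 1) ^+ (2 * d) / delta) <= m%:R ->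
  [/\ (d <= m)%N, 0 <= ln ((n%:R + 1) ^+ (2 * d) / delta),
      (n.+1 ^ (2 * d))%:R * expR (- ln ((n%:R + 1) ^+ (2 * d) / delta)) = delta &
      ((2 * n).+1 ^ (2 * d))%:R * expR (- (m%:R / 4)) <= delta / 4].
Proof.
move=> /andP[delta0 delta1] d0 n0 hm.
have n1 : 1 <= n%:R :> R by rewrite ler1n.
pose G : R := (2 * n%:R + 1) ^+ (2 * d); pose Q := 4 * G / delta.
pose H : R := (n%:R + 1) ^+ (2 * d).
have G0 : 0 < G by rewrite exprn_gt0//; lra.
have H1 : 1 <= H by apply: exprn_ege1; lra.
have Q0 : 0 < Q by rewrite divr_gt0// mulr_gt0.
have H0 : 0 < H / delta by rewrite divr_gt0//; lra.
have GE : ((2 * n).+1 ^ (2 * d))%:R = G by rewrite natrX -natr1 natrM.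
have HE : (n.+1 ^ (2 * d))%:R = H by rewrite natrX -natr1.
split.
(* The dimension is bounded through $e^{d/4}\le G\le Q$, hence $d\le 4\ln Q\le m$. [h_minus_exp_le]
   uses this to control the lost volume. *)
- rewrite -(ler_nat R); apply: le_trans hm.
  have GQ : G <= Q.
    rewrite /Q ler_pdivlMr//; apply: (@le_trans _ _ (G * 1)); last by lra.
    by rewrite ler_pM2l// ltW.
  have dG : expR (d%:R / 4) <= G.
    (* From $1-1/8\le e^{-1/8}$ one gets $e^{1/8}\le 8/7$; the constant 3 is the least value of
       $2n+1$. *)
    have e : expR (8^-1) <= 3 :> R.
      have := expR_ge1Dx (- 8^-1 : R); rewrite expRN => h.
      have : (1 - 8^-1) * expR (8^-1) <= 1 :> R by rewrite -ler_pdivlMr ?expR_gt0// div1r.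
      have := expR_gt0 (8^-1 : R); lra.
    have -> : d%:R / 4 = (2 * d)%:R * 8^-1 :> R by rewrite natrM; field.
    rewrite expRM_natl; apply: lerXn2r; rewrite ?nnegrE ?expR_ge0//; lra.
  have : d%:R / 4 <= ln Q.
    by rewrite -[leLHS]expRK ler_ln ?posrE ?expR_gt0//; exact: le_trans GQ.
  rewrite -/Q; lra.
- apply: ln_ge0; rewrite -/H ler_pdivlMr// mul1r; lra.
- by rewrite HE -/H expRN lnK ?posrE// invf_div mulrC divfK// gt_eqF//; lra.
- rewrite GE; apply: (@le_trans _ _ (G * Q^-1)).
    rewrite ler_pM2l// -[leRHS]lnK ?posrE ?invr_gt0// ler_expR lnV ?posrE//.
    by rewrite lerN2 -/Q -/G in hm *; lra.
  by have -> : G * Q^-1 = delta / 4 by rewrite /Q; field; rewrite !gt_eqF.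
Qed.

(** The bound is asserted on a measurable event [E] because [cost] and [Pi] are arbitrary functions,
    so the set of outcomes satisfying it may fail to be measurable. *)
Theorem theorem18 (R : realType) (dT : measure_display) (T : measurableType dT)
  (P : probability T R) (delta : R) (n d : nat) (beta : R) (m : nat)
  (hdelta : 0 < delta < 1 / 3) (hn : (1 <= n)%N) (hd : (1 <= d)%N)
  (hbeta : 2 <= beta) (hm : (1 <= m <= n)%N)
  (hm_log : 4 * ln (4 * (2 * n%:R + 1) ^+ (2 * d) / delta) <= m%:R)
  (Z : {RV P >-> (d.-tuple R * R)%type})
  (Zs : 'I_n -> {RV P >-> (d.-tuple R * R)%type})
  (h_indep : mutually_independent (fun i : option 'I_n => oapp Zs Z i))
  (h_ident : identically_distributed (fun i : option 'I_n => oapp Zs Z i))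
  (fX : d.-tuple R -> R) (M b : R) (hM : 0 < M) (hb : 0 < b)
  (hfX : has_density_on_cube P (fun w => (Z w).1) fX)
  (hfX_bounds : forall x, @unit_cube R d x -> b <= fX x <= M)
  (g : d.-tuple R -> R)
  (hg : is_cond_exp P (fun w => (Z w).1) (fun w => (Z w).2) g)
  (sigma : R)
  (h_noise : cond_subgaussian P (fun w => (Z w).1)
               (fun w => (Z w).2 - g (Z w).1) (sigma ^+ 2))
  (L : R) (hgL : lipschitz_dist2 (@unit_cube R d) g L)
  (cost : sample R d n -> sr_split R d -> cell R d -> R)
  (Pi : T -> seq (cell R d)) :
  let z (w : T) : sample R d n := [tuple Zs i w | i < n] in
  (forall w, sr_minimizers_exist (z w) m beta (cost (z w)) ->
     sr_final (z w) m beta (cost (z w)) (Pi w)) ->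
  exists E : set T,
    [/\ measurable E,
        ((1 - 3 * delta)%:E <= P E)%E &
        forall w, E w -> sr_minimizers_exist (z w) m beta (cost (z w)) ->
          forall x, @unit_cube R d x ->
            let V := local_map (Pi w) x in
            `|local_average (z w) V - g x| <=
              Num.sqrt (2 * sigma ^+ 2 / m%:R *
                        ln ((n%:R + 1) ^+ (2 * d) / delta))
              + lipschitz_const g V * beta * Num.sqrt d%:R *
                (5 * m%:R / (n%:R * b)) `^ (d%:R^-1)].
Proof.
move=> z hPi.
have /andP[delta0 delta3] := hdelta; have delta1 : delta < 1 by lra.
have [m0 mn] := andP hm.
have delta01 : 0 < delta < 1 by rewrite delta0.
have [dm l0 lE mE] := confidence_numerics delta01 hd hn hm_log.
set l := ln _ in l0 lE *.
have v0 : 0 <= sigma ^+ 2 by exact: sqr_ge0.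
have mg : measurable_fun setT g by case: hg.
have iZ : mutually_independent Zs.
  exact: (mutually_independent_comp (h := Some) (fun i j => @Some_inj _ i j) h_indep).
have idZ i (A : set (d.-tuple R * R)) : measurable A ->
    distribution P (Zs i) A = distribution P Z A.
  by move=> mA; exact: (h_ident (Some i) None).
pose C : R := n%:R * n%:R * d%:R * M ^+ 2.
have C0 : 0 < C by rewrite !mulr_gt0 ?ltr0n// exprn_gt0.
(* Collisions have total probability at most $n^2d\cdot 2K(M/K)^2=2C/K$, and $K\ge 4C/\delta$ makes
   this at most $\delta/2$. *)
pose K := (Num.truncn (4 * C / delta)).+1.
have K0 : (0 < K)%N by [].
have CK : 4 * C / delta <= K%:R.
  by apply: ltW; have /andP[] := truncn_itv (ltW (divr_gt0 (mulr_gt0 (ltr0n R 4) C0) delta0)).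
have [mB1 PB1] := probability_finite_union (P := P) (a := fun=> 0)
  (fun i => proj1 (outside_cube_null idZ hfX i))
  (fun i => eq_ind_r (fun x => (x <= 0)%E) (lexx _) (proj2 (outside_cube_null idZ hfX i))).
(* Diagonal pairs are assigned the empty event, so that the union runs over all triples. *)
pose B2 (u : 'I_n * 'I_n * 'I_d) : set T :=
  if u.1.1 == u.1.2 then set0 else [set w |
    level K (tnth (Zs u.1.1 w).1 u.2) = level K (tnth (Zs u.1.2 w).1 u.2)].
have B2P u : measurable (B2 u) /\ (P (B2 u) <= (K.+1%:R * (M / K%:R) ^+ 2)%:E)%E.
  rewrite /B2; case: eqP => [_|/eqP ij]; last exact: (collision_le _ idZ hb hM hfX).
  by rewrite measure0 lee_fin mulr_ge0// exprn_ge0// divr_ge0// ltW.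
have [mB2 PB2] := probability_finite_union (fun u => proj1 (B2P u)) (fun u => proj2 (B2P u)).
(* Both signs are needed to bound the absolute value of the noise sums; this doubles the cost
   [delta] of the rank rules. *)
pose sg (s : bool) : R := if s then 1 else -1.
have sg1 s : sg s ^+ 2 = 1 by rewrite /sg; case: s; rewrite ?sqrrN expr1n.
have noiseP (u : {ffun 'I_d -> 'I_n.+1 * 'I_n.+1} * bool) :=
  selected_noise_tail v0 iZ idZ mg h_noise (@measurable_code_fiber R d K)
    (rank_box u.1) (sg1 u.2) l0.
have [mB3 PB3] := probability_finite_union (fun u => proj1 (noiseP u)) (fun u => proj2 (noiseP u)).
have boxP q := sparse_box_le iZ idZ q m0.
have [mB4 PB4] := probability_finite_union (fun q => proj1 (boxP q)) (fun q => proj2 (boxP q)).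
set U1 := \bigcup_i _ in mB1 PB1; set U2 := \bigcup_i _ in mB2 PB2.
set U3 := \bigcup_i _ in mB3 PB3; set U4 := \bigcup_i _ in mB4 PB4.
have {}PB1 : (P U1 <= 0)%E by rewrite big1 in PB1.
have {}PB2 : (P U2 <= (delta / 2)%:E)%E.
  apply: (le_trans PB2); rewrite lee_fin sumr_const !card_prod !card_ord.
  rewrite -[leLHS]mulr_natl !natrM.
  have K0' : 0 < K%:R :> R by rewrite ltr0n.
  have KS : K.+1%:R <= 2 * K%:R :> R by have : (1 : R) <= K%:R; [rewrite ler1n|rewrite -natr1; lra].
  apply: (@le_trans _ _ (n%:R * n%:R * d%:R * (2 * K%:R * (M / K%:R) ^+ 2))).
    by rewrite ler_wpM2l// ler_wpM2r// sqr_ge0.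
  rewrite (_ : _ * _ = 2 * C / K%:R); last by rewrite /C; field; rewrite gt_eqF.
  by move: CK; rewrite ler_pdivrMr// ler_pdivrMr//; lra.
have {}PB3 : (P U3 <= (2 * delta)%:E)%E.
  apply: (le_trans PB3); rewrite lee_fin sumr_const.
  rewrite card_prod card_bool card_ffun card_prod !card_ord.
  by rewrite mulnn -expnM -[leLHS]mulr_natl natrM mulrAC lE mulrC.
have {}PB4 : (P U4 <= (delta / 4)%:E)%E.
  apply: (le_trans PB4); rewrite lee_fin sumr_const.
  by rewrite card_ffun card_prod !card_ord mulnn -expnM -[leLHS]mulr_natl.
have mU12 : measurable (U1 `|` U2) by exact: measurableU.
have mU123 : measurable (U1 `|` U2 `|` U3) by exact: measurableU.
have mU : measurable (U1 `|` U2 `|` U3 `|` U4) by exact: measurableU.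
(* The costs are 0 outside the cube, $\delta/2$ for collisions, $2\delta$ for the noise and
   $\delta/4$ for sparse boxes: $11\delta/4$ in all. *)
have PU : (P (U1 `|` U2 `|` U3 `|` U4) <= (3 * delta)%:E)%E.
  apply: (le_trans (measureU2 P mU123 mB4)).
  apply: (le_trans (leeD (measureU2 P mU12 mB3) PB4)).
  apply: (le_trans (leeD (leeD (measureU2 P mB1 mB2) PB3) (lexx _))).
  apply: (le_trans (leeD (leeD (leeD PB1 PB2) (lexx _)) (lexx _))).
  by rewrite -!EFinD lee_fin; lra.
exists (~` (U1 `|` U2 `|` U3 `|` U4)); split.
- exact: measurableC.
- rewrite probability_setC// EFinB; exact: leeB.
move=> w Ew zmin x xc.
have zE i : tnth (z w) i = Zs i w by rewrite tnth_mktuple.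
pose p (q : {ffun 'I_d -> 'I_(2 * n).+1 * 'I_(2 * n).+1}) :=
  fine (P ((fun w => (Z w).1) @^-1` grid_box q)).
have cubeZ i : unit_cube (Zs i w).1.
  by apply: contrapT => zi; apply: Ew; left; left; left; exists i.
have mbox lo hi : measurable ((fun w => (Z w).1) @^-1` box lo hi).
  have mB : measurable [set x : d.-tuple R * R | box lo hi x.1].
    by rewrite -[X in measurable X]setTI; apply: measurable_fst => //; exact: measurable_box.
  exact: (measurable_preimage_RV Z mB).
(* The cube has volume 1 and its probability is at least [b]. *)
have b1 : b <= 1.
  have := density_box_ge hb hfX hfX_bounds (lo := fun=> 0) (hi := fun=> 1).
  under eq_bigr do rewrite subr0; rewrite big1// mulr1 => /(_ _)/le_trans h.
  rewrite -lee_fin; apply: h => //; exact: probability_le1 (mbox _ _).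
apply: (@sr_tree_error R d n m K (z w) beta b L l (sigma ^+ 2) (cost (z w)) (Pi w) g p) => //.
- by rewrite hd.
- by apply: le_trans hbeta; lra.
- by rewrite hb.
- by move=> i; rewrite zE.
- move=> i j k ij; rewrite !zE; apply: contra_notN Ew => /eqP ijk.
  left; left; right; exists (i, j, k) => //=.
  by rewrite /B2 /= (negbTE ij).
- move=> ab /=; set A := rank_box _ _.
  have AE : A = rank_box ab [ffun i => code K (Zs i w).1].
    by rewrite /A; congr rank_box; apply/ffunP => i; rewrite !ffunE zE.
  have noiseb s : sg s * \sum_(i in A) ((Zs i w).2 - g (Zs i w).1) <=
      Num.sqrt (2 * sigma ^+ 2 * #|A|%:R * l).
    rewrite leNgt; apply: contra_notN Ew => h.
    by left; right; exists (ab, s) => //=; rewrite -AE.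
  under eq_bigr do rewrite zE.
  have := noiseb true; have := noiseb false; rewrite /sg mul1r mulN1r => hN hP.
  by rewrite ler_norml lerNl hN.
- move=> q qle; rewrite -lee_fin fineK ?fin_num_measure//; last exact: mbox.
  apply: (density_box_ge hb hfX hfX_bounds) => k.
  have n20 : 0 < (2 * n)%:R :> R by rewrite ltr0n muln_gt0.
  rewrite divr_ge0// ler_pM2r ?invr_gt0// ler_nat qle ler_pdivrMr// mul1r ler_nat.
  by split => //; rewrite -ltnS.
- move=> q qn; rewrite leqNgt; apply: contra_notN Ew => h.
  right; exists q => //=; split => //; apply: leq_ltn_trans h.
  by apply: subset_leq_card; apply/fintype.subsetP => i; rewrite !inE zE.
- exact: hPi.
Qed.
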